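(* Let $m,n\ge1$ be integers and let $P\in\mathbb{R}$ be such that $n^2<m^2<P$. Then there exists $0<E_2<\infty$ such that: (i) if $-\frac{(P-m^2)^2}{4}<E_{\Theta_m}\le-\frac{(P-m^2)^2}{4}+\frac{(m^2-n^2)^2}{4}$ and $E_{\Theta_m}\neq0$ then $\Theta_m$ is linearly unstable with respect to $\Theta_n$; in particular, if $2m^2-n^2-P\ge0$ then the linear instability occurs whenever $E_{\Theta_m}<0$; (ii) if $E_{\Theta_m}>E_2$ then $\Theta_m$ is linearly stable with respect to $\Theta_n$.
   Context: $\Theta_m$ denotes any solution $\Theta_m:\mathbb{R}\to\mathbb{R}$ of the Duffing equation $$\ddot{\Theta}_m(t)+m^2(m^2-P)\Theta_m(t)+m^4\Theta_m(t)^3=0 ,$$ and its (constant) energy is $$E_{\Theta_m}=\frac{\dot{\Theta}_m(0)^2}{2}+\frac{m^2(m^2-P)}{2}\Theta_m(0)^2+\frac{m^4}{4}\Theta_m(0)^4 .$$ The assertions hold for every solution $\Theta_m$ whose energy lies in the indicated range. $\Theta_m$ is said to be linearly stable (unstable) with respect to the $n$-th mode $\Theta_n$ if $\xi\equiv0$ is a stable (unstable) solution of the Hill equation $$\ddot{\xi}+a(t)\xi=0,\qquad a(t)=n^2(n^2-P)+m^2n^2\Theta_m(t)^2 ;$$ stability of $\xi\equiv0$ is equivalent to all solutions $\xi$ being bounded on $\mathbb{R}$, and unstable means not stable. *)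

(* Defs.v *)
(* Stdlib reals with Coquelicot. *)
From Stdlib Require Import Reals.
From Coquelicot Require Import Coquelicot.
Open Scope R_scope.

(* The first conjunct is not redundant: [Derive] is total, so differentiability
   of [Derive f] alone says nothing about differentiability of [f]. *)
Definition twice_differentiable (f : R -> R) : Prop :=
  forall t : R, ex_derive f t /\ ex_derive (Derive f) t.

Definition duffing_solution (m : nat) (P : R) (Theta : R -> R) : Prop :=
  twice_differentiable Theta /\
  forall t : R,
    Derive (Derive Theta) t
      + INR m ^ 2 * (INR m ^ 2 - P) * Theta t
      + INR m ^ 4 * Theta t ^ 3 = 0.

Definition energy (m : nat) (P : R) (Theta : R -> R) : R :=
  Derive Theta 0 ^ 2 / 2
    + INR m ^ 2 * (INR m ^ 2 - P) / 2 * Theta 0 ^ 2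
    + INR m ^ 4 / 4 * Theta 0 ^ 4.

Definition hill_solution (a xi : R -> R) : Prop :=
  twice_differentiable xi /\
  forall t : R, Derive (Derive xi) t + a t * xi t = 0.

(* Lyapunov stability of the zero solution in the phase plane (xi, xi'),
   forward in time from every initial instant t0. As the equation is linear,
   each solution with initial data at t0 extends to all of R (for continuous
   a), so quantifying over global solutions loses nothing. *)
Definition zero_stable (a : R -> R) : Prop :=
  forall t0 eps : R, 0 < eps ->
  exists delta : R, 0 < delta /\
    forall xi : R -> R, hill_solution a xi ->
      Rabs (xi t0) < delta -> Rabs (Derive xi t0) < delta ->
      forall t : R, t0 <= t ->
        Rabs (xi t) < eps /\ Rabs (Derive xi t) < eps.

Definition hill_coef (m n : nat) (P : R) (Theta : R -> R) (t : R) : R :=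
  INR n ^ 2 * (INR n ^ 2 - P) + INR m ^ 2 * INR n ^ 2 * Theta t ^ 2.

Definition linearly_stable (m n : nat) (P : R) (Theta : R -> R) : Prop :=
  zero_stable (hill_coef m n P Theta).

Definition linearly_unstable (m n : nat) (P : R) (Theta : R -> R) : Prop :=
  ~ linearly_stable m n P Theta.

(* Main.v *)
Require Import Defs.
From Stdlib Require Import Reals ZArith Lra Lia Classical.
From Coquelicot Require Import Coquelicot.
Open Scope R_scope.

(* Put x = m Theta, mu = m^2, b = P - m^2, c = m^2 - n^2 > 0, q = mu (x^2 - b). Then x'' + q x = 0, and
   the Hill coefficient is a = n^2 (x^2 - (b + c)) = g (q - mu c) with g = n^2 / m^2 < 1.

   In (i), energy conservation gives x^2 <= b + c, i.e. a <= 0, so (xi xi')' = xi'^2 - a xi^2 >= 0 and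
   xi^2 grows at least linearly when xi(0) = xi'(0) > 0.

   In (ii), x is antiperiodic with half-period tau. The equation v'' + q v = 0 has the explicit
   solutions x and x' + (mu / 2) x \int x^2, among which there is one without zeros
   between any t and t + tau. Picone's identity and g < 1 then show that no nontrivial solution of
   xi'' + a xi = 0 vanishes at both t and t + tau. As a also has positive mean once the energy is
   large, the equation lies strictly inside its first stability zone. *)

(** Sturm comparison of [a = g (q - mu c)] with [q] fails pointwise: at a zero of [x],
    [a - q = (m^2 - n^2) (b - n^2)], which is positive once [b > n^2]. Quadratic forms are compared
    instead. For [y] vanishing at both ends of an interval, [\int (y'^2 - a y^2)] equals [(1 - g)
    \int y'^2 + g mu c \int y^2 + g \int (y'^2 - q y^2)], and the last integral is nonnegative as
    soon as [v'' + q v = 0] has a solution without zeros inside. On intervals of length [tau], [x]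
    is such a solution only when they start at one of its zeros; this is why a second, explicit
    solution enters.

    The two ingredients of (ii) are complementary. Since [a] depends on [x^2], it has period [tau].
    A real Floquet multiplier would belong to a solution with [y (t + tau) = k y t]. If that
    solution vanishes, it does so at two points [tau] apart, which the comparison excludes. If it
    does not, [u = y' / y] is periodic with [u' = - a - u^2], so the mean of [a] is at most 0, which
    the high energy excludes. *)

Lemma nonneg_derive_le (f df : R -> R) (p r : R) :
  p <= r ->
  (forall t, p <= t <= r -> is_derive f t (df t)) ->
  (forall t, p <= t <= r -> 0 <= df t) -> f p <= f r.
Proof.
  intros Hpr Hd Hpos.
  destruct (MVT_gen f p r df) as [t [Ht He]];
    try rewrite Rmin_left, Rmax_right in * by lra.
  - intros t Ht. apply Hd. lra.
  - intros t Ht. apply derivable_continuous_pt.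
    exists (df t). apply is_derive_Reals, Hd, Ht.
  - specialize (Hpos t Ht). nra.
Qed.

Lemma zero_derive_const (f : R -> R) (s t : R) :
  (forall t, is_derive f t 0) -> f s = f t.
Proof.
  intros Hd.
  assert (H : forall p r, p <= r -> f p = f r).
  { intros p r Hpr. apply Rle_antisym.
    - apply (nonneg_derive_le f (fun _ => 0)); auto; intros; lra.
    - apply Ropp_le_cancel.
      apply (nonneg_derive_le (fun u => - f u) (fun _ => 0)); auto; try (intros; lra).
      intros u _. rewrite <- Ropp_0. now apply @is_derive_opp. }
  destruct (Rle_dec s t) as [Hst|Hst]; [|symmetry]; apply H; lra.
Qed.

(** * The equation [y'' + a y = 0]: superposition, translation, uniqueness *)

(** The derivative is a second argument because combinations, translates and explicit solutions come
    with a closed form for it, whereas [hill_solution] works with [Derive y]. *)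
Definition linear_solution (a y y1 : R -> R) : Prop :=
  forall t, is_derive y t (y1 t) /\ is_derive y1 t (- (a t * y t)).

(* [auto_derive] leaves the eta-expanded [Derive (fun x => f x)]. *)
Ltac derive_of H :=
  match type of H with
  | is_derive ?f ?t ?l =>
      let E := fresh in
      assert (E : Derive (fun x => f x) t = l) by exact (is_derive_unique f t l H);
      rewrite ?E; clear E
  end.

Lemma hill_solution_linear (a y : R -> R) :
  hill_solution a y -> linear_solution a y (Derive y).
Proof.
  intros [Hd He] t. destruct (Hd t) as [H1 H2]. split.
  - now apply Derive_correct.
  - replace (- (a t * y t)) with (Derive (Derive y) t) by (specialize (He t); lra).
    now apply Derive_correct.
Qed.

Lemma linear_solution_Derive (a y y1 : R -> R) (t : R) :
  linear_solution a y y1 -> Derive y t = y1 t.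
Proof. intros H. apply is_derive_unique, H. Qed.

Lemma linear_solution_hill (a y y1 : R -> R) :
  linear_solution a y y1 -> hill_solution a y.
Proof.
  intros H.
  assert (H2 : forall t, is_derive (Derive y) t (- (a t * y t))).
  { intros t. apply (is_derive_ext y1); [|apply H].
    intros u. now rewrite (linear_solution_Derive a y y1 u H). }
  split.
  - intros t. split; [exists (y1 t); apply (proj1 (H t))|eexists; apply (H2 t)].
  - intros t. rewrite (is_derive_unique _ _ _ (H2 t)). ring.
Qed.

Lemma linear_solution_comb (a y y1 z z1 : R -> R) (k l : R) :
  linear_solution a y y1 -> linear_solution a z z1 ->
  linear_solution a (fun t => k * y t + l * z t) (fun t => k * y1 t + l * z1 t).
Proof.
  intros Hy Hz t.
  destruct (Hy t) as [Y1 Y2], (Hz t) as [Z1 Z2]. split.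
  - auto_derive; [repeat split; eexists; eassumption|].
    derive_of Y1; derive_of Z1. ring.
  - auto_derive; [repeat split; eexists; eassumption|].
    derive_of Y2; derive_of Z2. ring.
Qed.

Lemma is_derive_shift (f : R -> R) (h t l : R) :
  is_derive f (t + h) l -> is_derive (fun u => f (u + h)) t l.
Proof.
  intros H. auto_derive.
  - eexists; apply H.
  - derive_of H. ring.
Qed.

Lemma linear_solution_shift (a y y1 : R -> R) (h : R) :
  (forall t, a (t + h) = a t) -> linear_solution a y y1 ->
  linear_solution a (fun t => y (t + h)) (fun t => y1 (t + h)).
Proof.
  intros Ha H t. destruct (H (t + h)) as [H1 H2]. split.
  - now apply is_derive_shift.
  - rewrite Ha in H2. now apply is_derive_shift.
Qed.

(** Gronwall's argument: [e = y^2 + y1^2] satisfies [|e'| <= (1 + M) e], so [e] times a decaying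
    exponential is nonincreasing after [t0], and [e] times a growing one is nondecreasing before
    it. *)
Lemma linear_solution_unique0 (a y y1 : R -> R) (M t0 : R) :
  (forall t, Rabs (a t) <= M) -> linear_solution a y y1 ->
  y t0 = 0 -> y1 t0 = 0 -> forall t, y t = 0 /\ y1 t = 0.
Proof.
  intros Ha H H0 H1 t.
  assert (HM : forall t, - M <= a t <= M) by (intros; apply Rabs_le_between, Ha).
  set (e := fun u => y u ^ 2 + y1 u ^ 2).
  assert (Hb : forall k u, is_derive (fun u => e u * exp (k * u)) u
     (exp (k * u) * (2 * y u * y1 u * (1 - a u) + k * (y u ^ 2 + y1 u ^ 2)))).
  { intros k u. destruct (H u) as [Y1 Y2]. unfold e.
    auto_derive; [repeat split; eexists; eassumption|].
    derive_of Y1; derive_of Y2. ring. }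
  assert (He0 : e t0 = 0) by (unfold e; rewrite H0, H1; ring).
  assert (Hpm : forall u, Rabs (2 * y u * y1 u * (1 - a u)) <= (1 + M) * (y u ^ 2 + y1 u ^ 2)).
  { intros u. rewrite Rabs_mult. rewrite Rmult_comm. specialize (HM u).
    apply Rmult_le_compat; try apply Rabs_pos; apply Rabs_le; [lra|].
    assert (S1 := pow2_ge_0 (y u - y1 u)). assert (S2 := pow2_ge_0 (y u + y1 u)).
    split; nra. }
  assert (Het : e t <= 0).
  { destruct (Rle_dec t0 t) as [Hle|Hle].
    - assert (HH : - (e t0 * exp (- (1 + M) * t0)) <= - (e t * exp (- (1 + M) * t))).
      { apply (nonneg_derive_le (fun u => - (e u * exp (- (1 + M) * u)))
         (fun u => - (exp (- (1 + M) * u) * (2 * y u * y1 u * (1 - a u) + - (1 + M) * (y u ^ 2 + y1 u ^ 2)))) _ _ Hle).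
        - intros u _. apply @is_derive_opp. apply Hb.
        - intros u _. assert (X := Hpm u). apply Rabs_le_between in X.
          assert (X2 := exp_pos (- (1 + M) * u)). nra. }
      rewrite He0 in HH. assert (X := exp_pos (- (1 + M) * t)). nra.
    - assert (HH : e t * exp ((1 + M) * t) <= e t0 * exp ((1 + M) * t0)).
      { apply (nonneg_derive_le (fun u => (e u * exp ((1 + M) * u)))
         (fun u => (exp ((1 + M) * u) * (2 * y u * y1 u * (1 - a u) + (1 + M) * (y u ^ 2 + y1 u ^ 2))))); try lra.
        - intros u _. apply Hb.
        - intros u _. assert (X := Hpm u). apply Rabs_le_between in X.
          assert (X2 := exp_pos ((1 + M) * u)). nra. }
      rewrite He0 in HH. assert (X := exp_pos ((1 + M) * t)). nra. }
  unfold e in Het. split; nra.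
Qed.

Lemma linear_solution_unique (a y y1 z z1 : R -> R) (M t0 : R) :
  (forall t, Rabs (a t) <= M) ->
  linear_solution a y y1 -> linear_solution a z z1 ->
  y t0 = z t0 -> y1 t0 = z1 t0 -> forall t, y t = z t /\ y1 t = z1 t.
Proof.
  intros Ha Hy Hz H0 H1 t.
  destruct (linear_solution_unique0 a _ _ M t0 Ha
    (linear_solution_comb a y y1 z z1 1 (-1) Hy Hz)) with t; lra.
Qed.

(** * Existence on the whole line by Picard iteration *)

Lemma is_derive_primitive (g : R -> R) (t : R) :
  (forall s, continuous g s) -> is_derive (fun u => RInt g 0 u) t (g t).
Proof.
  intros Hg. apply (is_derive_RInt g _ 0); [|apply Hg].
  apply filter_forall. intros u. apply (RInt_correct (V := R_CompleteNormedModule)).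
  apply (ex_RInt_continuous (V := R_CompleteNormedModule)). intros; apply Hg.
Qed.

(** Integration from 0 has norm at most [1 / L] for the weighted norm [sup |f t| exp (- L |t|)].
    This makes Picard iteration contract on all of [R] at once. The four cases of the proof are the
    signs of [t] and of [G], all reduced to [Hone]. *)
Lemma primitive_exp_bound (G g : R -> R) (L K t : R) :
  G 0 = 0 -> (forall s, is_derive G s (g s)) -> 0 <= K ->
  (forall s, Rabs (g s) <= L * K * exp (L * Rabs s)) ->
  Rabs (G t) <= K * exp (L * Rabs t).
Proof.
  intros H0 Hd HK Hb.
  assert (Hone : forall (F f : R -> R) r, 0 <= r -> F 0 = 0 ->
    (forall s, is_derive F s (f s)) ->
    (forall s, 0 <= s -> - f s <= L * K * exp (L * s)) ->
    - F r <= K * exp (L * r)).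
  { intros F f r Hr HF HFd Hfb.
    assert (X : F 0 + K * exp (L * 0) <= F r + K * exp (L * r)).
    { apply (nonneg_derive_le (fun s => F s + K * exp (L * s))
        (fun s => f s + K * (L * exp (L * s)))); trivial.
      - intros s _. assert (HFs := HFd s).
        auto_derive; [eexists; exact HFs|]. derive_of HFs. ring.
      - intros s Hs. specialize (Hfb s (proj1 Hs)). lra. }
    rewrite Rmult_0_r, exp_0 in X. lra. }
  assert (Hopp : forall s, is_derive (fun u => G (- u)) s (- g (- s))).
  { intros s. assert (Hs := Hd (- s)). auto_derive; [eexists; exact Hs|].
    derive_of Hs. ring. }
  assert (Hg : forall s, - (L * K * exp (L * Rabs s)) <= g s <= L * K * exp (L * Rabs s))
    by (intros; apply Rabs_le_between, Hb).
  apply Rabs_le. destruct (Rle_dec 0 t) as [Ht|Ht].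
  - rewrite (Rabs_pos_eq t Ht). split.
    + enough (- G t <= K * exp (L * t)) by lra.
      apply (Hone G g); trivial. intros s Hs. specialize (Hg s).
      rewrite (Rabs_pos_eq s Hs) in Hg. lra.
    + rewrite <- (Ropp_involutive (G t)).
      apply (Hone (fun s => - G s) (fun s => - g s)); trivial; [lra| |].
      * intros s. apply @is_derive_opp, Hd.
      * intros s Hs. specialize (Hg s).
        rewrite (Rabs_pos_eq s Hs) in Hg. lra.
  - rewrite (Rabs_left t) by lra. split.
    + rewrite <- (Ropp_involutive t) at 2.
      enough (- G (- - t) <= K * exp (L * - t)) by lra.
      apply (Hone (fun s => G (- s)) (fun s => - g (- s))); trivial; [lra| |].
      * now rewrite Ropp_0.
      * intros s Hs. specialize (Hg (- s)).
        rewrite Rabs_Ropp, (Rabs_pos_eq s Hs) in Hg. lra.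
    + rewrite <- (Ropp_involutive (G t)), <- (Ropp_involutive t) at 1.
      apply (Hone (fun s => - G (- s)) (fun s => - - g (- s))); trivial; [lra| | |].
      * rewrite Ropp_0. lra.
      * intros s. apply @is_derive_opp, Hopp.
      * intros s Hs. specialize (Hg (- s)).
        rewrite Rabs_Ropp, (Rabs_pos_eq s Hs) in Hg. lra.
Qed.

Lemma geometric_steps_cv (w : nat -> R) (C : R) :
  (forall k, Rabs (w (S k) - w k) <= C * (/ 2) ^ k) ->
  exists l, forall k, Rabs (l - w k) <= 2 * C * (/ 2) ^ k.
Proof.
  intros Hw.
  assert (HC : 0 <= C).
  { specialize (Hw O). simpl in Hw. assert (X := Rabs_pos (w 1%nat - w O)). lra. }
  assert (Hp : forall k, 0 < (/ 2) ^ k) by (intros; apply pow_lt; lra).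
  (* The exact geometric sum, with its subtracted term, is what closes the induction on [j]. *)
  assert (Hj : forall k j, Rabs (w (k + j)%nat - w k) <= 2 * C * (/ 2) ^ k - 2 * C * (/ 2) ^ (k + j)).
  { intros k j. induction j as [|j IH].
    - rewrite Nat.add_0_r, Rminus_diag, Rabs_R0. lra.
    - rewrite Nat.add_succ_r. replace (w (S (k + j)) - w k)
        with ((w (S (k + j)) - w (k + j)%nat) + (w (k + j)%nat - w k)) by ring.
      eapply Rle_trans; [apply Rabs_triang|].
      specialize (Hw (k + j)%nat). simpl. lra. }
  assert (Hcv : is_lim_seq (fun k => 2 * C * (/ 2) ^ k) 0).
  { replace (Finite 0) with (Rbar_mult (2 * C) 0) by (simpl; f_equal; ring).
    apply is_lim_seq_scal_l, is_lim_seq_geom. rewrite Rabs_pos_eq; lra. }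
  assert (Hex : ex_finite_lim_seq w).
  { apply ex_lim_seq_cauchy_corr. intros eps.
    apply is_lim_seq_spec in Hcv.
    destruct (Hcv (pos_div_2 eps)) as [N HN]. exists N.
    assert (HX : forall n, (N <= n)%nat -> Rabs (w n - w N) < eps / 2).
    { intros n Hn. replace n with (N + (n - N))%nat by lia.
      eapply Rle_lt_trans; [apply Hj|].
      specialize (HN N (le_n N)). rewrite Rminus_0_r in HN. apply Rabs_def2 in HN.
      simpl in HN. assert (X := Hp (N + (n - N))%nat). nra. }
    intros n m Hn Hm. replace (w n - w m) with ((w n - w N) + - (w m - w N)) by ring.
    eapply Rle_lt_trans; [apply Rabs_triang|]. rewrite Rabs_Ropp.
    assert (X1 := HX n Hn). assert (X2 := HX m Hm). lra. }
  destruct Hex as [l Hl]. exists l. intros k.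
  assert (HL : is_lim_seq (fun j => Rabs (w (j + k)%nat - w k)) (Rabs (l - w k))).
  { apply (is_lim_seq_abs _ (l - w k)), is_lim_seq_minus';
      [now apply is_lim_seq_incr_n|apply is_lim_seq_const]. }
  apply (is_lim_seq_le _ _ (Rabs (l - w k)) (2 * C * (/ 2) ^ k) ) with (2 := HL) (3 := is_lim_seq_const _).
  intros j. rewrite Nat.add_comm. eapply Rle_trans; [apply Hj|].
  assert (X := Hp (k + j)%nat). nra.
Qed.

Lemma exp_le_exp (x y : R) : x <= y -> exp x <= exp y.
Proof. intros [H|<-]; [left; now apply exp_increasing|apply Rle_refl]. Qed.

Fixpoint picard (a : R -> R) (u0 v0 : R) (k : nat) : (R -> R) * (R -> R) :=
  match k with
  | O => (fun _ => u0, fun _ => v0)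
  | S j =>
      (fun t => u0 + RInt (snd (picard a u0 v0 j)) 0 t,
       fun t => v0 + RInt (fun s => - (a s * fst (picard a u0 v0 j) s)) 0 t)
  end.

(** As [zero_stable] quantifies over global solutions, instability has to exhibit one, and the
    stability criterion rests on a fundamental system; both come from here. *)
Lemma linear_solution_exists (a : R -> R) (M u0 v0 : R) :
  (forall t, continuous a t) -> (forall t, Rabs (a t) <= M) ->
  exists y y1, linear_solution a y y1 /\ y 0 = u0 /\ y1 0 = v0.
Proof.
  intros Hc Ha'.
  (* The system [u' = v], [v' = - a u] has Lipschitz constant at most [1 + M]; an exponential rate
     twice as large makes each Picard step halve the increment ([Hstep]). *)
  set (L := 2 * (1 + M)).
  assert (HM : 0 <= M) by (eapply Rle_trans; [apply Rabs_pos|apply (Ha' 0)]).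
  set (U := fun k => fst (picard a u0 v0 k)).
  set (V := fun k => snd (picard a u0 v0 k)).
  set (dU := fun k => match k with O => fun _ => 0 | S j => V j end).
  set (dV := fun k => match k with O => fun _ => 0 | S j => fun t => - (a t * U j t) end).
  assert (HD : forall k, (forall t, is_derive (U k) t (dU k t)) /\ (forall t, is_derive (V k) t (dV k t))).
  { induction k as [|k [IU IV]].
    - split; intros t; [exact (is_derive_const u0 t)|exact (is_derive_const v0 t)].
    - assert (Haff : forall g c, (forall s, continuous g s) ->
        forall t, is_derive (fun u => c + RInt g 0 u) t (g t)).
      { intros g c Hg t. assert (X := is_derive_primitive g t Hg).
        rewrite <- (Rplus_0_l (g t)).
        exact (is_derive_plus _ _ _ _ _ (is_derive_const c t) X). }
      split.
      + apply Haff. intros s. apply (ex_derive_continuous (V := R_NormedModule)); eexists; apply IV.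
      + apply (Haff (fun s => - (a s * U k s))). intros s.
        apply (continuous_opp (V := R_NormedModule) (fun t => a t * U k t)).
        apply (continuous_mult (K := R_AbsRing) a (U k)); [apply Hc|].
        apply (ex_derive_continuous (V := R_NormedModule)); eexists; apply IU. }
  assert (H0 : forall k, U k 0 = u0 /\ V k 0 = v0).
  { intros [|k]; split; trivial; unfold U, V; simpl; rewrite RInt_point;
      apply Rplus_0_r. }
  set (C := Rabs u0 + Rabs v0).
  assert (HC : Rabs u0 <= C /\ Rabs v0 <= C /\ 0 <= C).
  { unfold C. assert (X := Rabs_pos u0). assert (Y := Rabs_pos v0). lra. }
  assert (HE : forall t, 1 <= exp (L * Rabs t)).
  { intros t. rewrite <- exp_0. apply exp_le_exp.
    apply Rmult_le_pos; [unfold L; lra|apply Rabs_pos]. }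
  assert (Hstep : forall k t,
    Rabs (U (S k) t - U k t) <= C * (/ 2) ^ k * exp (L * Rabs t) /\
    Rabs (V (S k) t - V k t) <= C * (/ 2) ^ k * exp (L * Rabs t)).
  { induction k as [|k IH]; intros t.
    - assert (Y : forall s, C <= L * (C * 1) * exp (L * Rabs s) /\ M * C <= L * (C * 1) * exp (L * Rabs s)).
      { intros s. specialize (HE s). unfold L in *.
        set (e := exp _) in *. clearbody e.
        assert (0 <= C * (e - 1)) by (apply Rmult_le_pos; lra).
        assert (0 <= M * C) by (apply Rmult_le_pos; lra).
        assert (0 <= M * (C * (e - 1))) by (apply Rmult_le_pos; lra). split; nra. }
      simpl pow. split.
      + apply (primitive_exp_bound (fun t => U 1%nat t - U O t) (fun t => V O t - 0)); try lra.
        * destruct (H0 1%nat), (H0 O); lra.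
        * intros s. apply @is_derive_minus; [apply (HD 1%nat)|apply (HD O)].
        * intros s. unfold V; simpl. rewrite Rminus_0_r.
          specialize (Y s). lra.
      + apply (primitive_exp_bound (fun t => V 1%nat t - V O t) (fun t => - (a t * U O t) - 0)); try lra.
        * destruct (H0 1%nat), (H0 O); lra.
        * intros s. apply @is_derive_minus; [apply (HD 1%nat)|apply (HD O)].
        * intros s. unfold U; simpl. rewrite Rminus_0_r, Rabs_Ropp, Rabs_mult.
          apply Rle_trans with (M * C); [|apply Y].
          apply Rmult_le_compat; try apply Rabs_pos; [apply Ha'|lra].
    - assert (Hp : 0 <= C * (/ 2) ^ k) by (apply Rmult_le_pos; [lra|apply pow_le; lra]).
      simpl pow. split.
      + apply (primitive_exp_bound (fun t => U (S (S k)) t - U (S k) t) (fun t => V (S k) t - V k t)).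
        * destruct (H0 (S (S k))), (H0 (S k)); lra.
        * intros s. apply @is_derive_minus; [apply (HD (S (S k)))|apply (HD (S k))].
        * lra.
        * intros s. eapply Rle_trans; [apply IH|].
          apply Rmult_le_compat_r; [specialize (HE s); lra|]. unfold L.
          assert (0 <= M * (C * (/ 2) ^ k)) by (apply Rmult_le_pos; lra). nra.
      + apply (primitive_exp_bound (fun t => V (S (S k)) t - V (S k) t)
          (fun t => - (a t * U (S k) t) - - (a t * U k t))).
        * destruct (H0 (S (S k))), (H0 (S k)); lra.
        * intros s. apply @is_derive_minus; [apply (HD (S (S k)))|apply (HD (S k))].
        * lra.
        * intros s. replace (- (a s * U (S k) s) - - (a s * U k s))
            with (- (a s * (U (S k) s - U k s))) by ring.
          rewrite Rabs_Ropp, Rabs_mult.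
          apply Rle_trans with (M * (C * (/ 2) ^ k * exp (L * Rabs s))).
          { apply Rmult_le_compat; try apply Rabs_pos; [apply Ha'|apply IH]. }
          rewrite <- Rmult_assoc. apply Rmult_le_compat_r; [specialize (HE s); lra|].
          unfold L. nra. }
  assert (Hlim : forall W : nat -> R -> R,
    (forall k t, Rabs (W (S k) t - W k t) <= C * (/ 2) ^ k * exp (L * Rabs t)) ->
    exists w : R -> R, forall k t, Rabs (w t - W k t) <= 2 * C * (/ 2) ^ k * exp (L * Rabs t)).
  { intros W HW.
    exists (fun t => real (Lim_seq (fun k => W k t))).
    intros k t.
    destruct (geometric_steps_cv (fun k => W k t) (C * exp (L * Rabs t))) as [l Hl].
    { intros j. specialize (HW j t). lra. }
    replace (real (Lim_seq _)) with l; [specialize (Hl k); lra|].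
    rewrite (is_lim_seq_unique _ l); trivial.
    assert (Hg : is_lim_seq (fun k => 2 * (C * exp (L * Rabs t)) * (/ 2) ^ k) 0).
    { replace (Finite 0) with (Rbar_mult (2 * (C * exp (L * Rabs t))) 0) by (simpl; f_equal; ring).
      apply is_lim_seq_scal_l, is_lim_seq_geom. rewrite Rabs_pos_eq; lra. }
    assert (Hz : is_lim_seq (fun k => l - W k t) 0).
    { apply is_lim_seq_abs_0. apply (is_lim_seq_le_le (fun _ => 0)) with (3 := Hg).
      - intros j; split; [apply Rabs_pos|apply Hl].
      - apply is_lim_seq_const. }
    apply (is_lim_seq_ext (fun k => l - (l - W k t))); [intros; ring|].
    replace (Finite l) with (Finite (l - 0)) by (f_equal; ring).
    apply is_lim_seq_minus'; [apply is_lim_seq_const|exact Hz]. }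
  destruct (Hlim U) as [y Hy]; [intros; apply Hstep|].
  destruct (Hlim V) as [y1 Hy1]; [intros; apply Hstep|].
  (* The factor [1 + M] lets one estimate give locally uniform convergence both of the iterates and
     of their products with [a]. *)
  assert (Hunif : forall (W : nat -> R -> R) w,
    (forall k t, Rabs (w t - W k t) <= 2 * C * (/ 2) ^ k * exp (L * Rabs t)) ->
    forall t eps, 0 < eps -> exists N, forall k s, (N <= k)%nat -> Rabs (s - t) < 1 ->
      (1 + M) * Rabs (w s - W k s) < eps).
  { intros W w HW t eps Heps.
    set (B := (1 + M) * (2 * C * exp (L * (Rabs t + 1)))).
    assert (Hg : is_lim_seq (fun k => B * (/ 2) ^ k) 0).
    { replace (Finite 0) with (Rbar_mult B 0) by (simpl; f_equal; ring).
      apply is_lim_seq_scal_l, is_lim_seq_geom. rewrite Rabs_pos_eq; lra. }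
    apply is_lim_seq_spec in Hg. destruct (Hg (mkposreal eps Heps)) as [N HN].
    exists N. intros k s Hk Hs. specialize (HN k Hk). simpl in HN.
    rewrite Rminus_0_r in HN. apply Rabs_def2 in HN.
    apply Rle_lt_trans with (2 := proj1 HN). unfold B.
    rewrite !Rmult_assoc. apply Rmult_le_compat_l; [lra|].
    eapply Rle_trans; [apply HW|].
    assert (He : exp (L * Rabs s) <= exp (L * (Rabs t + 1))).
    { apply exp_le_exp, Rmult_le_compat_l; [unfold L; lra|].
      replace s with ((s - t) + t) by ring.
      eapply Rle_trans; [apply Rabs_triang|]. lra. }
    assert (Hp : 0 <= 2 * C * (/ 2) ^ k) by (apply Rmult_le_pos; [lra|apply pow_le; lra]).
    assert (X := Rmult_le_compat_l _ _ _ Hp He). lra. }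
  assert (Hpt : forall (W : nat -> R -> R) w,
    (forall k t, Rabs (w t - W k t) <= 2 * C * (/ 2) ^ k * exp (L * Rabs t)) ->
    forall t, Un_cv (fun k => W k t) (w t)).
  { intros W w HW t eps Heps.
    destruct (Hunif W w HW t eps Heps) as [N HN]. exists N. intros k Hk.
    specialize (HN k t Hk). rewrite Rminus_diag, Rabs_R0 in HN. specialize (HN Rlt_0_1).
    unfold Rdist. rewrite Rabs_minus_sym. assert (X := Rabs_pos (w t - W k t)). nra. }
  exists y, y1. split; [|split].
  - intros t. split; apply is_derive_Reals.
    (* The index is shifted because the derivative of [U (S k)] is [V k]. *)
    + apply (CVU_derivable (fun k => U (S k)) V y y1 t (mkposreal 1 Rlt_0_1)).
      * intros eps Heps. destruct (Hunif V y1 Hy1 t eps Heps) as [N HN]. exists N.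
        intros k s Hk Hs. specialize (HN k s Hk Hs). assert (X := Rabs_pos (y1 s - V k s)). nra.
      * intros s _ eps Heps. destruct (Hpt U y Hy s eps Heps) as [N HN]. exists N.
        intros k Hk. apply HN. lia.
      * intros k s _. apply is_derive_Reals, (HD (S k)).
      * unfold Boule. rewrite Rminus_diag, Rabs_R0. simpl. lra.
    + apply (CVU_derivable (fun k => V (S k)) (fun k t => - (a t * U k t)) y1 (fun t => - (a t * y t)) t (mkposreal 1 Rlt_0_1)).
      * intros eps Heps. destruct (Hunif U y Hy t eps Heps) as [N HN]. exists N.
        intros k s Hk Hs. specialize (HN k s Hk Hs).
        replace (- (a s * y s) - - (a s * U k s)) with (- (a s * (y s - U k s))) by ring.
        rewrite Rabs_Ropp, Rabs_mult.
        assert (X := Rabs_pos (y s - U k s)). specialize (Ha' s). nra.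
      * intros s _ eps Heps. destruct (Hpt V y1 Hy1 s eps Heps) as [N HN]. exists N.
        intros k Hk. apply HN. lia.
      * intros k s _. apply is_derive_Reals, (HD (S k)).
      * unfold Boule. rewrite Rminus_diag, Rabs_R0. simpl. lra.
  - apply (UL_sequence (fun k => U k 0)); [now apply Hpt|].
    intros eps Heps. exists O. intros k _. rewrite (proj1 (H0 k)).
    unfold Rdist. now rewrite Rminus_diag, Rabs_R0.
  - apply (UL_sequence (fun k => V k 0)); [now apply Hpt|].
    intros eps Heps. exists O. intros k _. rewrite (proj2 (H0 k)).
    unfold Rdist. now rewrite Rminus_diag, Rabs_R0.
Qed.

(** * Periodic functions and behaviour near a zero *)

Lemma periodic_Z {T : Type} (f : R -> T) (tau : R) (k : Z) (s : R) :
  (forall s, f (s + tau) = f s) -> f (s + IZR k * tau) = f s.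
Proof.
  intros Hf.
  assert (Hn : forall n s, f (s + INR n * tau) = f s).
  { induction n as [|n IH]; intros u.
    - simpl. now rewrite Rmult_0_l, Rplus_0_r.
    - rewrite S_INR. replace (u + (INR n + 1) * tau) with ((u + INR n * tau) + tau) by ring.
      now rewrite Hf. }
  destruct (Z_le_gt_dec 0 k) as [Hk|Hk].
  - rewrite <- (Z2Nat.id k) by lia. rewrite <- INR_IZR_INZ. apply Hn.
  - rewrite <- (Hn (Z.to_nat (- k))). f_equal.
    rewrite INR_IZR_INZ, Z2Nat.id by lia. rewrite opp_IZR. ring.
Qed.

Lemma period_translate (tau z t : R) :
  0 < tau -> exists k, z <= t + IZR k * tau < z + tau.
Proof.
  intros Htau.
  destruct (base_Int_part ((t - z) / tau)) as [K1 K2].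
  exists (- Int_part ((t - z) / tau))%Z.
  rewrite opp_IZR. assert (E : t - z = (t - z) / tau * tau) by (field; lra).
  split; nra.
Qed.

Lemma continuous_locally_neq0 (f : R -> R) (t : R) :
  continuous f t -> f t <> 0 ->
  exists d : posreal, forall s, Rabs (s - t) < d -> f s <> 0.
Proof.
  intros Hc Hf. assert (Hp : 0 < Rabs (f t)) by now apply Rabs_pos_lt.
  destruct (proj1 (filterlim_locally f (f t)) Hc (mkposreal _ Hp)) as [d Hd].
  exists d. intros s Hs E. specialize (Hd s Hs).
  unfold ball in Hd; simpl in Hd; unfold AbsRing_ball, abs, minus, plus, opp in Hd; simpl in Hd.
  rewrite E, Rplus_0_l, Rabs_Ropp in Hd. lra.
Qed.

(** Together with the lower bound at a simple zero that follows, this gives [y^2 / v = O(|s - t|)]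
    at a common zero [t] of [y] and [v], which Picone's identity requires at the end points. *)
Lemma linear_growth_at_zero (f : R -> R) (t l : R) :
  is_derive f t l -> f t = 0 ->
  exists d : posreal, forall s, Rabs (s - t) < d -> Rabs (f s) <= (Rabs l + 1) * Rabs (s - t).
Proof.
  intros Hd Hf. apply is_derive_Reals in Hd.
  destruct (Hd 1 Rlt_0_1) as [d Hdd]. exists d. intros s Hs.
  destruct (Req_dec s t) as [->|Hst].
  - rewrite Hf, Rminus_diag, Rabs_R0, Rmult_0_r. apply Rle_refl.
  - assert (Hh : s - t <> 0) by lra.
    specialize (Hdd (s - t) Hh Hs). replace (t + (s - t)) with s in Hdd by ring.
    rewrite Hf, Rminus_0_r in Hdd.
    replace (f s) with (((f s / (s - t) - l) + l) * (s - t)) by (field; trivial).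
    rewrite Rabs_mult. apply Rmult_le_compat_r; [apply Rabs_pos|].
    eapply Rle_trans; [apply Rabs_triang|]. lra.
Qed.

Lemma simple_zero_growth (f : R -> R) (t l : R) :
  is_derive f t l -> f t = 0 -> l <> 0 ->
  exists d : posreal, forall s, Rabs (s - t) < d -> Rabs l / 2 * Rabs (s - t) <= Rabs (f s).
Proof.
  intros Hd Hf Hl. assert (Hp : 0 < Rabs l / 2) by (apply Rabs_pos_lt in Hl; lra).
  apply is_derive_Reals in Hd.
  destruct (Hd _ Hp) as [d Hdd]. exists d. intros s Hs.
  destruct (Req_dec s t) as [->|Hst].
  - rewrite Rminus_diag, Rabs_R0, Rmult_0_r. apply Rabs_pos.
  - assert (Hh : s - t <> 0) by lra.
    specialize (Hdd (s - t) Hh Hs). replace (t + (s - t)) with s in Hdd by ring.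
    rewrite Hf, Rminus_0_r in Hdd.
    assert (X := Rabs_triang_inv l (l - f s / (s - t))).
    replace (l - (l - f s / (s - t))) with (f s / (s - t)) in X by ring.
    rewrite (Rabs_minus_sym l) in X.
    rewrite Rabs_div in X by trivial.
    assert (Hh' : 0 < Rabs (s - t)) by now apply Rabs_pos_lt.
    apply (Rmult_le_reg_r (/ Rabs (s - t))); [now apply Rinv_0_lt_compat|].
    replace (Rabs l / 2 * Rabs (s - t) * / Rabs (s - t)) with (Rabs l / 2) by (field; lra).
    fold (Rabs (f s) / Rabs (s - t)). lra.
Qed.

(** The nonzero slope isolates the zero [z], so the supremum [r] of the [t] with no zero in [(z, t]]
    lies to the right of [z]; it is finite because of [z'], and a zero by continuity. *)
Lemma next_zero (f : R -> R) (z l z' : R) :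
  (forall t, continuous f t) -> is_derive f z l -> f z = 0 -> l <> 0 ->
  z < z' -> f z' = 0 ->
  exists r, z < r /\ f r = 0 /\ forall t, z < t < r -> f t <> 0.
Proof.
  intros Hc Hd Hz Hl Hzz' Hz'.
  set (S := fun t => forall s, z < s <= t -> f s <> 0).
  destruct (simple_zero_growth f z l Hd Hz Hl) as [d Hdd].
  assert (Hd0 := cond_pos d).
  assert (Hp : 0 < Rabs l) by now apply Rabs_pos_lt.
  assert (HS : S (z + d / 2)).
  { intros s Hs E. specialize (Hdd s). rewrite Rabs_pos_eq in Hdd by lra.
    rewrite E, Rabs_R0 in Hdd. assert (0 < Rabs l / 2 * (s - z)) by (apply Rmult_lt_0_compat; lra).
    assert (s - z < d) by lra. specialize (Hdd H0). lra. }
  destruct (completeness S) as [r [Hub Hlub]].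
  - exists z'. intros t Ht. destruct (Rle_dec t z') as [|Hn]; trivial.
    exfalso. apply (Ht z'); [lra|trivial].
  - now exists (z + d / 2).
  - assert (Hr : z < r) by (specialize (Hub _ HS); lra).
    assert (Hne : forall t, z < t < r -> f t <> 0).
    { intros t Ht E. assert (r <= t); [|lra]. apply Hlub. intros u Hu.
      destruct (Rle_dec u t) as [|Hn]; trivial. exfalso. apply (Hu t); [lra|trivial]. }
    exists r. split; [trivial|split; [|trivial]].
    apply NNPP. intros Hfr.
    destruct (continuous_locally_neq0 f r (Hc r) Hfr) as [e He].
    assert (He0 := cond_pos e).
    assert (HS2 : S (r + e / 2)).
    { intros s Hs. destruct (Rlt_dec s r) as [Hlt|Hlt]; [apply Hne; lra|].
      apply He. rewrite Rabs_pos_eq; lra. }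
    specialize (Hub _ HS2). lra.
Qed.

(** * The Duffing flow: energy, symmetries, antiperiodicity, mean square *)

(** The third clause is the first integral, normalised so that [E] is the energy of [Theta] itself
    when [x = m Theta]. *)
Definition duffing_flow (mu b E : R) (x x1 : R -> R) : Prop :=
  forall t, is_derive x t (x1 t) /\
    is_derive x1 t (- (mu * (x t ^ 2 - b) * x t)) /\
    x1 t ^ 2 = mu * (2 * E + b * x t ^ 2 - x t ^ 4 / 2).

Lemma duffing_solution_flow (m : nat) (P : R) (Theta : R -> R) :
  (1 <= m)%nat -> duffing_solution m P Theta ->
  duffing_flow (INR m ^ 2) (P - INR m ^ 2) (energy m P Theta)
    (fun t => INR m * Theta t) (fun t => INR m * Derive Theta t).
Proof.
  intros Hm [Hd He].
  assert (D1 : forall t, is_derive Theta t (Derive Theta t)) by (intros; apply Derive_correct, Hd).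
  assert (D2 : forall t, is_derive (Derive Theta) t (Derive (Derive Theta) t)) by (intros; apply Derive_correct, Hd).
  intros t. split; [|split].
  - exact (is_derive_scal _ _ (INR m) _ (D1 t)).
  - assert (X := is_derive_scal _ _ (INR m) _ (D2 t)).
    specialize (He t). replace (- (_ * _)) with (INR m * Derive (Derive Theta) t); [exact X|].
    replace (Derive (Derive Theta) t) with (- (INR m ^ 2 * (INR m ^ 2 - P) * Theta t + INR m ^ 4 * Theta t ^ 3)) by lra.
    ring.
  - set (G := fun t => Derive Theta t ^ 2 / 2
      + INR m ^ 2 * (INR m ^ 2 - P) / 2 * Theta t ^ 2 + INR m ^ 4 / 4 * Theta t ^ 4).
    assert (HG : G t = G 0).
    { apply zero_derive_const. intros s. specialize (He s).
      assert (X1 := D1 s). assert (X2 := D2 s). unfold G.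
      auto_derive; [repeat split; eexists; eassumption|].
      derive_of X2. derive_of X1.
      replace (Derive (Derive Theta) s) with (- (INR m ^ 2 * (INR m ^ 2 - P) * Theta s + INR m ^ 4 * Theta s ^ 3)) by lra.
      field. }
    change (energy m P Theta) with (G 0). rewrite <- HG. unfold G. field.
Qed.

Lemma duffing_flow_linear (mu b E : R) (x x1 : R -> R) :
  duffing_flow mu b E x x1 -> linear_solution (fun t => mu * (x t ^ 2 - b)) x x1.
Proof. intros H t. destruct (H t) as [H1 [H2 _]]. now split. Qed.

(** Completing the square in [0 <= 2 E + b x^2 - x^4 / 2], which is the nonnegative [x1^2] divided
    by [mu]. *)
Lemma duffing_flow_bound (mu b E : R) (x x1 : R -> R) (t : R) :
  0 < mu -> duffing_flow mu b E x x1 -> (x t ^ 2 - b) ^ 2 <= 4 * E + b ^ 2.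
Proof.
  intros Hmu H. destruct (H t) as [_ [_ He]].
  assert (X : 0 <= 2 * E + b * x t ^ 2 - x t ^ 4 / 2).
  { apply (Rmult_le_reg_l mu); trivial. rewrite <- He, Rmult_0_r. apply pow2_ge_0. }
  nra.
Qed.

Lemma duffing_flow_bounded (mu b E : R) (x x1 : R -> R) :
  0 < mu -> duffing_flow mu b E x x1 -> exists B, forall t, x t ^ 2 <= B.
Proof.
  intros Hmu H. exists (b + (1 + (4 * E + b ^ 2))). intros t.
  assert (X := duffing_flow_bound mu b E x x1 t Hmu H). assert (Y := pow2_ge_0 (x t ^ 2 - b - 1)). nra.
Qed.

Lemma duffing_flow_continuous (mu b E : R) (x x1 : R -> R) (t : R) :
  duffing_flow mu b E x x1 -> continuous x t.
Proof.
  intros H. apply (ex_derive_continuous (V := R_NormedModule)).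
  exists (x1 t). apply H.
Qed.

Lemma duffing_flow_shift (mu b E h : R) (x x1 : R -> R) :
  duffing_flow mu b E x x1 ->
  duffing_flow mu b E (fun t => x (t + h)) (fun t => x1 (t + h)).
Proof.
  intros H t. destruct (H (t + h)) as [H1 [H2 H3]].
  split; [|split]; trivial; now apply is_derive_shift.
Qed.

Lemma duffing_flow_opp (mu b E : R) (x x1 : R -> R) :
  duffing_flow mu b E x x1 ->
  duffing_flow mu b E (fun t => - x t) (fun t => - x1 t).
Proof.
  intros H t. destruct (H t) as [H1 [H2 H3]].
  split; [|split].
  - now apply @is_derive_opp.
  - replace (- (mu * ((- x t) ^ 2 - b) * - x t)) with (- - (mu * (x t ^ 2 - b) * x t)) by ring.
    now apply @is_derive_opp.
  - replace ((- x1 t) ^ 2) with (x1 t ^ 2) by ring. rewrite H3. field.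
Qed.

Lemma duffing_flow_reflect (mu b E : R) (x x1 : R -> R) :
  duffing_flow mu b E x x1 ->
  duffing_flow mu b E (fun t => x (- t)) (fun t => - x1 (- t)).
Proof.
  intros H t. destruct (H (- t)) as [H1 [H2 H3]].
  split; [|split].
  - auto_derive; [eexists; exact H1|]. derive_of H1. ring.
  - auto_derive; [eexists; exact H2|]. derive_of H2. ring.
  - rewrite <- H3. ring.
Qed.

(* The difference of two solutions solves a linear equation with bounded coefficient. *)
Lemma duffing_flow_unique (mu b E F : R) (x x1 z z1 : R -> R) (t0 : R) :
  0 < mu -> duffing_flow mu b E x x1 -> duffing_flow mu b F z z1 ->
  x t0 = z t0 -> x1 t0 = z1 t0 -> forall t, x t = z t /\ x1 t = z1 t.
Proof.
  intros Hmu Hx Hz H0 H1 t.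
  destruct (duffing_flow_bounded _ _ _ _ _ Hmu Hx) as [A HA].
  destruct (duffing_flow_bounded _ _ _ _ _ Hmu Hz) as [B HB].
  destruct (linear_solution_unique0
    (fun s => mu * (x s ^ 2 + x s * z s + z s ^ 2 - b))
    (fun s => x s - z s) (fun s => x1 s - z1 s) (mu * (2 * A + 2 * B + Rabs b)) t0) with t;
    try lra.
  - intros s. rewrite Rabs_mult, (Rabs_pos_eq mu) by lra.
    apply Rmult_le_compat_l; [lra|]. apply Rabs_le.
    specialize (HA s). specialize (HB s). assert (Y := Rabs_le_between b (Rabs b)).
    assert (Rabs b <= Rabs b) by lra. apply Y in H.
    assert (S1 := pow2_ge_0 (x s - z s)). assert (S2 := pow2_ge_0 (x s + z s)).
    assert (S3 := pow2_ge_0 (x s)). assert (S4 := pow2_ge_0 (z s)). split; nra.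
  - intros s. destruct (Hx s) as [X1 [X2 _]], (Hz s) as [Z1 [Z2 _]]. split.
    + exact (is_derive_minus _ _ _ _ _ X1 Z1).
    + replace (- _) with (minus (- (mu * (x s ^ 2 - b) * x s)) (- (mu * (z s ^ 2 - b) * z s))).
      * exact (is_derive_minus _ _ _ _ _ X2 Z2).
      * unfold minus, plus, opp; simpl. ring.
Qed.

(* [w = x1 / x] satisfies [w' = - mu (x^2 / 2 + 2 E / x^2) <= - (1 + w^2) / 2], so [atan w] cannot stay bounded. *)
Lemma duffing_flow_zero_exists (mu b e : R) (x x1 : R -> R) (t0 : R) :
  1 <= mu -> 0 < b -> b + 1 <= e -> duffing_flow mu b (e ^ 2) x x1 ->
  exists z, t0 <= z /\ x z = 0.
Proof.
  intros Hmu Hb He H. apply NNPP. intros Hno.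
  assert (Hx : forall t, t0 <= t -> x t <> 0) by (intros t Ht E; apply Hno; now exists t).
  set (df := fun t => (- (mu * (x t ^ 2 - b) * x t) * x t - x1 t * x1 t) / x t ^ 2 / (1 + (x1 t / x t) ^ 2) + / 2).
  (* Over a length 10 the arctangent would drop by at least 5, but its range has width [PI <= 4]. *)
  assert (X : - (atan (x1 t0 / x t0) + t0 / 2) <= - (atan (x1 (t0 + 10) / x (t0 + 10)) + (t0 + 10) / 2)).
  { apply (nonneg_derive_le (fun t => - (atan (x1 t / x t) + t / 2)) (fun t => - df t)); [lra| |].
    - intros t Ht. destruct (H t) as [H1 [H2 _]]. specialize (Hx t (proj1 Ht)).
      auto_derive; [repeat split; trivial; eexists; eassumption|].
      derive_of H1. derive_of H2. unfold df. field. 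
      split; trivial. assert (0 < x t ^ 2) by nra. assert (0 <= x1 t ^ 2) by nra. nra.
    - intros t Ht. destruct (H t) as [_ [_ H3]]. specialize (Hx t (proj1 Ht)). unfold df.
      assert (S1 : 0 < x t ^ 2) by nra. assert (S2 : 0 <= x1 t ^ 2) by nra.
      replace (- _) with ((mu * (x t ^ 2 - b) * x t ^ 2 + x1 t ^ 2 / 2 - x t ^ 2 / 2) / (x t ^ 2 + x1 t ^ 2))
        by (field; split; trivial; nra).
      apply Rdiv_le_0_compat; [|lra]. rewrite H3.
      replace (x t ^ 4) with (x t ^ 2 * x t ^ 2) by ring.
      set (w := x t ^ 2) in *. clearbody w.
      assert (W := Rmult_le_compat_r w _ _ (Rlt_le _ _ S1) He). assert (W2 := pow2_ge_0 (w - e)).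
      (* The numerator is the sum of its value at [mu = 1], which is [W3], and of the excess
         [W4]. *)
      assert (W3 : 0 <= 3 * w * w / 4 + e ^ 2 - (b + 1) * w / 2) by nra.
      assert (W4 : 0 <= (mu - 1) * (3 * w * w / 4 + e ^ 2 - b * w / 2)) by (apply Rmult_le_pos; nra). nra. }
  assert (B1 := atan_bound (x1 t0 / x t0)).
  assert (B2 := atan_bound (x1 (t0 + 10) / x (t0 + 10))).
  assert (B3 := PI_4). lra.
Qed.

(** By uniqueness [x] is odd about a zero [z] and even about a critical point [p]. The composition
    of the two reflections is the translation by [2 (p - z)], under which [x] changes sign; this is
    the distance to the next zero [r]. *)
Lemma duffing_flow_antiperiod (mu b e : R) (x x1 : R -> R) :
  1 <= mu -> 0 < b -> b + 1 <= e -> duffing_flow mu b (e ^ 2) x x1 ->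
  exists z tau, 0 < tau /\ x z = 0 /\ (forall t, z < t < z + tau -> x t <> 0) /\
    forall t, x (t + tau) = - x t /\ x1 (t + tau) = - x1 t.
Proof.
  intros Hmu Hb He H.
  destruct (duffing_flow_zero_exists _ _ _ _ _ 0 Hmu Hb He H) as [z [_ Hz]].
  assert (Hz1 : x1 z <> 0).
  { intros E. destruct (H z) as [_ [_ H3]]. rewrite E, Hz in H3. nra. }
  destruct (duffing_flow_zero_exists _ _ _ _ _ (z + 1) Hmu Hb He H) as [z' [Hz' Hxz']].
  destruct (next_zero x z (x1 z) z') as [r [Hr [Hxr Hne]]]; trivial; try lra.
  { intros t. now apply duffing_flow_continuous with (1 := H). }
  { apply H. }
  destruct (MVT_gen x z r x1) as [p [Hp Ep]].
  { intros t _. apply H. }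
  { intros t _. apply continuity_pt_filterlim. now apply duffing_flow_continuous with (1 := H). }
  rewrite Rmin_left, Rmax_right in Hp by lra. rewrite Hxr, Hz in Ep.
  assert (Hp1 : x1 p = 0) by (apply (Rmult_eq_reg_r (r - z)); lra).
  assert (Hmu0 : 0 < mu) by lra.
  assert (Heven : forall t, x t = x (2 * p - t) /\ x1 t = - x1 (2 * p - t)).
  { intros t.
    assert (F := duffing_flow_reflect _ _ _ _ _ (duffing_flow_shift _ _ _ (2 * p) _ _ H)).
    destruct (duffing_flow_unique _ _ _ _ _ _ _ _ p Hmu0 H F) with t as [F1 F2].
    - f_equal; ring.
    - replace (- p + 2 * p) with p by ring. lra.
    - replace (2 * p - t) with (- t + 2 * p) by ring. now split. }
  assert (Hodd : forall t, x t = - x (2 * z - t) /\ x1 t = x1 (2 * z - t)).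
  { intros t.
    assert (F := duffing_flow_opp _ _ _ _ _ (duffing_flow_reflect _ _ _ _ _ (duffing_flow_shift _ _ _ (2 * z) _ _ H))).
    destruct (duffing_flow_unique _ _ _ _ _ _ _ _ z Hmu0 H F) with t as [F1 F2].
    - replace (- z + 2 * z) with z by ring. lra.
    - replace (- z + 2 * z) with z by ring. lra.
    - replace (2 * z - t) with (- t + 2 * z) by ring. split; lra. }
  (* Otherwise reflection in [p] would carry [z] or [r] to a zero strictly between them. *)
  assert (Hpr : 2 * p = z + r).
  { assert (Hpz : p <> z) by (intros ->; lra).
    assert (Hprn : p <> r).
    { intros ->. destruct (H r) as [_ [_ H3]]. rewrite Hp1, Hxr in H3. nra. }
    destruct (Rtotal_order (2 * p) (z + r)) as [C|[C|C]]; trivial; exfalso.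
    - apply (Hne (2 * p - z)); [lra|]. now rewrite <- (proj1 (Heven z)).
    - apply (Hne (2 * p - r)); [lra|]. now rewrite <- (proj1 (Heven r)). }
  exists z, (r - z). split; [lra|split; [trivial|split]].
  - intros t Ht. apply Hne. lra.
  - intros t. destruct (Heven (t + (r - z))) as [E1 E2]. destruct (Hodd t) as [O1 O2].
    replace (2 * p - (t + (r - z))) with (2 * z - t) in E1, E2 by lra. lra.
Qed.

(* Over a period, [(x x1)' = mu (2 E + 2 b x^2 - 3/2 x^4)] has zero mean, and [x^2 <= 4 e]. *)
Lemma duffing_flow_mean_square (mu b e tau t : R) (x x1 Z : R -> R) :
  0 < mu -> 0 < b -> b <= e -> 0 < tau -> duffing_flow mu b (e ^ 2) x x1 ->
  (forall s, x (s + tau) = - x s /\ x1 (s + tau) = - x1 s) ->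
  (forall s, is_derive Z s (x s ^ 2)) ->
  e / 3 * tau <= Z (t + tau) - Z t.
Proof.
  intros Hmu Hb He Htau H Hper HZ.
  (* The weight [6 e] is [3/2] times the bound [4 e] on [x^2]: the derivative becomes
     [mu x^2 (2 b + 6 e - 3/2 x^2) >= 0]. *)
  assert (X : x t * x1 t + mu * (6 * e * Z t - 2 * e ^ 2 * t)
    <= x (t + tau) * x1 (t + tau) + mu * (6 * e * Z (t + tau) - 2 * e ^ 2 * (t + tau))).
  { apply (nonneg_derive_le (fun s => x s * x1 s + mu * (6 * e * Z s - 2 * e ^ 2 * s))
     (fun s => mu * (2 * e ^ 2 + 2 * b * x s ^ 2 - 3 / 2 * x s ^ 4 + 6 * e * x s ^ 2 - 2 * e ^ 2))); [lra| |].
    - intros s _. destruct (H s) as [H1 [H2 H3]]. assert (H4 := HZ s).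
      auto_derive; [repeat split; trivial; eexists; eassumption|].
      derive_of H1. derive_of H2. derive_of H4.
      replace (1 * x1 s * x1 s) with (x1 s ^ 2) by ring. rewrite H3. field.
    - intros s _. assert (B := duffing_flow_bound _ _ _ _ _ s Hmu H).
      replace (x s ^ 4) with (x s ^ 2 * x s ^ 2) by ring.
      assert (S1 := pow2_ge_0 (x s)). set (w := x s ^ 2) in *. clearbody w.
      assert (w <= 4 * e) by nra.
      apply Rmult_le_pos; [lra|]. nra. }
  destruct (Hper t) as [P1 P2]. rewrite P1, P2 in X.
  assert (Y : mu * (e * (e * tau)) <= mu * (e * (3 * (Z (t + tau) - Z t)))) by nra.
  apply Rmult_le_reg_l in Y; [|lra]. apply Rmult_le_reg_l in Y; lra.
Qed.

(** * Picone comparison *)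

(* Where [v] vanishes, the quotient has the junk value [0], which is also its limit. *)
Lemma square_quotient_continuous (y v : R -> R) (t y' v' : R) :
  is_derive y t y' -> is_derive v t v' -> y t = 0 -> v t <> 0 \/ v' <> 0 ->
  continuity_pt (fun s => y s * y s / v s) t.
Proof.
  intros Hy Hv Hy0 Hor.
  destruct (Req_dec (v t) 0) as [Hv0|Hv0].
  2:{ apply continuity_pt_filterlim.
      apply (ex_derive_continuous (V := R_NormedModule) (fun s => y s * y s / v s)).
      auto_derive. repeat split; trivial; eexists; eassumption. }
  destruct Hor as [|Hv1]; [contradiction|].
  destruct (linear_growth_at_zero y t y' Hy Hy0) as [d1 H1].
  destruct (simple_zero_growth v t v' Hv Hv0 Hv1) as [d2 H2].
  assert (Hk : 0 < Rabs v' / 2) by (apply Rabs_pos_lt in Hv1; lra).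
  assert (HA : 0 < Rabs y' + 1) by (assert (X := Rabs_pos y'); lra).
  set (A := Rabs y' + 1) in *. set (k := Rabs v' / 2) in *.
  intros eps Heps.
  (* At distance [h] from [t], [|y| <= A h] and [|v| >= k h], so the quotient is at most
     [A^2 h / k]. *)
  exists (Rmin (Rmin d1 d2) (eps * k / (A * A))). split.
  - apply Rlt_gt. repeat apply Rmin_glb_lt; try apply cond_pos.
    apply Rdiv_lt_0_compat; apply Rmult_lt_0_compat; trivial.
  - intros s [[_ Hst] Hs]. unfold dist in *; simpl in *; unfold Rdist in *.
    assert (Hs1 : Rabs (s - t) < d1) by (eapply Rlt_le_trans; [apply Hs|]; eapply Rle_trans; [apply Rmin_l|apply Rmin_l]).
    assert (Hs2 : Rabs (s - t) < d2) by (eapply Rlt_le_trans; [apply Hs|]; eapply Rle_trans; [apply Rmin_l|apply Rmin_r]).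
    assert (Hs3 : Rabs (s - t) < eps * k / (A * A)) by (eapply Rlt_le_trans; [apply Hs|apply Rmin_r]).
    specialize (H1 s Hs1). specialize (H2 s Hs2).
    assert (Hp : 0 < Rabs (s - t)) by (apply Rabs_pos_lt; lra).
    assert (Hvs : v s <> 0). { intros E. rewrite E, Rabs_R0 in H2. nra. }
    rewrite Hy0. replace (0 * 0 / v t) with 0 by (unfold Rdiv; ring).
    rewrite Rminus_0_r, Rabs_div, Rabs_mult by trivial.
    assert (Hvp := Rabs_pos_lt _ Hvs).
    apply (Rmult_lt_reg_r (Rabs (v s))); trivial.
    replace (Rabs (y s) * Rabs (y s) / Rabs (v s) * Rabs (v s)) with (Rabs (y s) * Rabs (y s)) by (field; lra).
    assert (HAA : 0 < A * A) by now apply Rmult_lt_0_compat.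
    assert (Hs4 : Rabs (s - t) * (A * A) < eps * k).
    { apply (Rmult_lt_compat_r (A * A)) in Hs3; trivial.
      replace (eps * k / (A * A) * (A * A)) with (eps * k) in Hs3 by (field; lra). trivial. }
    assert (S := Rabs_pos (y s)). set (h := Rabs (s - t)) in *.
    apply Rle_lt_trans with ((A * h) * (A * h)); [apply Rmult_le_compat; trivial|].
    apply Rlt_le_trans with (eps * (k * h)); [|apply Rmult_le_compat_l; lra].
    replace (A * h * (A * h)) with (h * (A * A) * h) by ring.
    replace (eps * (k * h)) with (eps * k * h) by ring.
    apply Rmult_lt_compat_r; trivial.
Qed.

(* Picone's identity: [(y y1 - g y^2 v1 / v)' = (1 - g) y1^2 + g d y^2 + g (y1 - y v1 / v)^2], and
   Rolle's theorem applies between the zeros of [y]. *)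
Lemma no_two_zeros (q y y1 v v1 : R -> R) (g d p r M : R) :
  0 < g < 1 -> 0 < d -> p < r ->
  (forall t, Rabs (g * (q t - d)) <= M) ->
  linear_solution (fun t => g * (q t - d)) y y1 -> linear_solution q v v1 ->
  (forall t, p < t < r -> v t <> 0) ->
  v p <> 0 \/ v1 p <> 0 -> v r <> 0 \/ v1 r <> 0 ->
  y p = 0 -> y r = 0 -> y1 p = 0.
Proof.
  intros Hg Hd Hpr HM Hy Hv Hne Hvp Hvr Hyp Hyr.
  assert (Hcont : forall f l t, is_derive f t l -> continuity_pt f t).
  { intros f l t Hf. apply derivable_continuous_pt. exists l. now apply is_derive_Reals. }
  destruct (MVT_gen (fun t => y t * y1 t - g * (v1 t * (y t * y t / v t))) p r
    (fun t => (1 - g) * y1 t ^ 2 + g * d * y t ^ 2 + g * (y1 t - y t * v1 t / v t) ^ 2))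
    as [s [Hs He]]; try rewrite Rmin_left, Rmax_right in * by lra.
  - intros t Ht. specialize (Hne t Ht).
    destruct (Hy t) as [Y1 Y2], (Hv t) as [V1 V2].
    auto_derive; [repeat split; trivial; eexists; eassumption|].
    derive_of Y1. derive_of Y2. derive_of V1. derive_of V2. field; trivial.
  - intros t Ht. destruct (Hy t) as [Y1 Y2], (Hv t) as [V1 V2].
    apply continuity_pt_minus; [apply continuity_pt_mult; eapply Hcont; eassumption|].
    apply continuity_pt_scal, continuity_pt_mult; [eapply Hcont; eassumption|].
    destruct (Req_dec t p) as [->|Htp]; [|destruct (Req_dec t r) as [->|Htr]].
    + now apply square_quotient_continuous with (1 := Y1) (2 := V1).
    + now apply square_quotient_continuous with (1 := Y1) (2 := V1).
    + apply continuity_pt_filterlim.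
      apply (ex_derive_continuous (V := R_NormedModule) (fun s => y s * y s / v s)).
      assert (v t <> 0) by (apply Hne; lra).
      auto_derive. repeat split; trivial; eexists; eassumption.
  - rewrite Hyp, Hyr in He. unfold Rdiv in He.
    assert (E : (1 - g) * y1 s ^ 2 + g * d * y s ^ 2 + g * (y1 s - y s * v1 s / v s) ^ 2 = 0).
    { unfold Rdiv. apply (Rmult_eq_reg_r (r - p)); [|lra]. rewrite <- He. ring. }
    assert (E1 : 0 <= (1 - g) * y1 s ^ 2) by (apply Rmult_le_pos; [lra|apply pow2_ge_0]).
    assert (E2 : 0 <= g * d * y s ^ 2) by (apply Rmult_le_pos; [nra|apply pow2_ge_0]).
    assert (E3 : 0 <= g * (y1 s - y s * v1 s / v s) ^ 2) by (apply Rmult_le_pos; [lra|apply pow2_ge_0]).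
    assert (Hgd : 0 < g * d) by (apply Rmult_lt_0_compat; lra).
    assert (Hsq0 : forall k z, 0 < k -> k * z ^ 2 = 0 -> z = 0).
    { intros k z Hk Hz. apply Rsqr_0_uniq. rewrite Rsqr_pow2.
      apply Rmult_integral in Hz. lra. }
    (* As [g < 1] and [d > 0], the vanishing sum forces [y s = y1 s = 0], hence [y] is trivial. *)
    apply (linear_solution_unique0 _ y y1 M s HM Hy).
    + apply (Hsq0 (g * d)); lra.
    + apply (Hsq0 (1 - g)); lra.
Qed.

(** * Stability and instability criteria for Hill's equation *)

Lemma continuous_periodic_bounded (f : R -> R) (tau : R) :
  0 < tau -> (forall t, continuous f t) -> (forall t, f (t + tau) = f t) ->
  exists B, forall t, Rabs (f t) <= B.
Proof.
  intros Htau Hc Hper.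
  destruct (continuity_ab_maj (fun t => Rabs (f t)) 0 tau) as [T [HT _]]; [lra| |].
  - intros t _. apply continuity_pt_filterlim.
    apply (continuous_comp f Rabs); [apply Hc|apply continuous_Rabs].
  - exists (Rabs (f T)). intros t.
    destruct (period_translate tau 0 t Htau) as [k Hk].
    rewrite <- (periodic_Z f tau k t Hper). apply HT. lra.
Qed.

(* Let [f t] be the value at [t + tau] of the solution that vanishes at [t] with unit slope. It is
   periodic, has no zeros, and is a quadratic form in the fundamental solutions [c, s], invariant
   under the monodromy, of discriminant [disc]. If [disc >= 0], the periodic function [g = f' / f] satisfies
   [g' = - disc / (2 f^2) - 2 a - g^2 / 2 <= - 2 a], which is impossible as [a] has positive mean.
   If [disc < 0], the form is definite, so that it bounds [c, s] and their derivatives. *)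
Lemma hill_stable (a I : R -> R) (tau M : R) :
  0 < tau -> (forall t, continuous a t) -> (forall t, Rabs (a t) <= M) ->
  (forall t, a (t + tau) = a t) ->
  (forall t, is_derive I t (a t)) -> I 0 < I tau ->
  (forall t y y1, linear_solution a y y1 -> y t = 0 -> y (t + tau) = 0 -> y1 t = 0) ->
  zero_stable a.
Proof.
  intros Htau Hac HM Hper HI HIpos Hno.
  destruct (linear_solution_exists a M 1 0 Hac HM) as [c [c1 [Hc [Hc0 Hc10]]]].
  destruct (linear_solution_exists a M 0 1 Hac HM) as [s [s1 [Hs [Hs0 Hs10]]]].
  assert (HW : forall t, c t * s1 t - c1 t * s t = 1).
  { intros t. rewrite (zero_derive_const (fun t => c t * s1 t - c1 t * s t) t 0).
    - rewrite Hc0, Hc10, Hs0, Hs10. ring.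
    - intros u. destruct (Hc u) as [C1 C2], (Hs u) as [S1 S2].
      auto_derive; [repeat split; trivial; eexists; eassumption|].
      derive_of C1. derive_of C2. derive_of S1. derive_of S2. ring. }
  assert (Hrep : forall y y1, linear_solution a y y1 -> forall t,
     y t = y 0 * c t + y1 0 * s t /\ y1 t = y 0 * c1 t + y1 0 * s1 t).
  { intros y y1 Hy. apply (linear_solution_unique a y y1 _ _ M 0 HM Hy).
    - now apply linear_solution_comb.
    - rewrite Hc0, Hs0. ring.
    - rewrite Hc10, Hs10. ring. }
  set (A := c tau). set (C := c1 tau). set (B := s tau). set (D := s1 tau).
  assert (HdetM : A * D - C * B = 1) by apply HW.
  assert (HcT : forall t, c (t + tau) = A * c t + C * s t /\ c1 (t + tau) = A * c1 t + C * s1 t).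
  { intros t. assert (X := Hrep _ _ (linear_solution_shift a c c1 tau Hper Hc) t).
    simpl in X. rewrite !Rplus_0_l in X. exact X. }
  assert (HsT : forall t, s (t + tau) = B * c t + D * s t /\ s1 (t + tau) = B * c1 t + D * s1 t).
  { intros t. assert (X := Hrep _ _ (linear_solution_shift a s s1 tau Hper Hs) t).
    simpl in X. rewrite !Rplus_0_l in X. exact X. }
  (* [Q u w] is the determinant of [(u, w)] and its monodromy image [(A u + C w, B u + D w)], hence
     invariant as the monodromy has determinant 1. At [(c t, s t)] it equals
     [c t * s (t + tau) - s t * c (t + tau)]. *)
  set (Q := fun u w => B * u ^ 2 + (D - A) * u * w - C * w ^ 2).
  assert (HQ : forall u w, Q (A * u + C * w) (B * u + D * w) = Q u w).
  { intros u w. transitivity ((A * D - C * B) * Q u w); [unfold Q; ring|].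
    rewrite HdetM; ring. }
  set (f := fun t => Q (c t) (s t)).
  set (h := fun t => Q (c1 t) (s1 t)).
  assert (Hf : forall t, f (t + tau) = f t).
  { intros t. unfold f. destruct (HcT t) as [-> _], (HsT t) as [-> _]. apply HQ. }
  assert (Hh : forall t, h (t + tau) = h t).
  { intros t. unfold h. destruct (HcT t) as [_ ->], (HsT t) as [_ ->]. apply HQ. }
  assert (Hf0 : forall t, f t <> 0).
  { intros t E.
    assert (X := linear_solution_comb a s s1 c c1 (c t) (- s t) Hs Hc).
    assert (Y := Hno t _ _ X). simpl in Y.
    destruct (HcT t) as [E1 _], (HsT t) as [E2 _]. rewrite E1, E2 in Y.
    assert (Z := HW t). unfold f, Q in E.
    assert (c t * s1 t + - s t * c1 t = 0) by (apply Y; lra). lra. }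
  set (f1 := fun t => 2 * B * c t * c1 t + (D - A) * (c1 t * s t + c t * s1 t) - 2 * C * s t * s1 t).
  assert (Hfd : forall t, is_derive f t (f1 t)).
  { intros t. destruct (Hc t) as [C1 C2], (Hs t) as [S1 S2]. unfold f, Q, f1.
    auto_derive; [repeat split; trivial; eexists; eassumption|].
    derive_of C1. derive_of S1. ring. }
  assert (Hf1 : f1 tau = f1 0).
  { rewrite <- (is_derive_unique _ _ _ (Hfd 0)).
    apply eq_sym, is_derive_unique, (is_derive_ext (fun t => f (t + tau))); [exact Hf|].
    apply is_derive_shift. rewrite Rplus_0_l. apply Hfd. }
  (* Because of [HdetM] this is [(A + D)^2 - 4], so [disc < 0] says that the trace of the monodromy
     lies strictly between -2 and 2. *)
  set (disc := (D - A) ^ 2 + 4 * B * C).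
  assert (Hdisc : disc < 0).
  { apply Rnot_le_lt. intros Hdisc.
    assert (X : - (f1 0 / f 0 + 2 * I 0) <= - (f1 tau / f tau + 2 * I tau)).
    { apply (nonneg_derive_le (fun t => - (f1 t / f t + 2 * I t))
        (fun t => disc / (2 * f t ^ 2) + (f1 t / f t) ^ 2 / 2)); [lra| |].
      - intros t _. destruct (Hc t) as [C1 C2], (Hs t) as [S1 S2].
        assert (F := Hfd t). assert (I1 := HI t). specialize (Hf0 t).
        unfold f1 at 1.
        auto_derive; [repeat split; trivial; eexists; eassumption|].
        derive_of C1. derive_of S1. derive_of C2. derive_of S2. derive_of F. derive_of I1.
        (* Gram identity for [Q] at the vectors [(c, s)] and [(c1, s1)]: [f1] is twice the polar
           form, and the determinant is the Wronskian. *)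
        assert (Key : disc * (c t * s1 t - c1 t * s t) ^ 2 = f1 t ^ 2 -
          4 * f t * (B * c1 t ^ 2 + (D - A) * c1 t * s1 t - C * s1 t ^ 2))
          by (unfold disc, f, f1, Q; ring).
        rewrite HW in Key. replace disc with (disc * 1 ^ 2) by ring. rewrite Key.
        fold (f1 t). change (f t) with (Q (c t) (s t)) in Hf0 |- *. unfold f1, Q in *. field. trivial.
      - intros t _. specialize (Hf0 t).
        assert (0 < f t ^ 2) by nra.
        assert (0 <= disc / (2 * f t ^ 2)) by (apply Rdiv_le_0_compat; lra).
        assert (S2 := pow2_ge_0 (f1 t / f t)). lra. }
    rewrite Hf1 in X. assert (Y := Hf 0). rewrite Rplus_0_l in Y. rewrite Y in X. lra. }
  assert (Hcont : forall y y1, linear_solution a y y1 -> forall t, continuous y t /\ continuous y1 t).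
  { intros y y1 Hy t. destruct (Hy t).
    split; apply (ex_derive_continuous (V := R_NormedModule)); eexists; eassumption. }
  destruct (continuous_periodic_bounded f tau Htau) as [F HF]; trivial.
  { intros t. apply (ex_derive_continuous (V := R_NormedModule)). eexists. apply Hfd. }
  destruct (continuous_periodic_bounded h tau Htau) as [H HH]; trivial.
  { intros t. apply (ex_derive_continuous (V := R_NormedModule)).
    destruct (Hc t) as [_ C2], (Hs t) as [_ S2]. unfold h, Q.
    auto_derive. repeat split; trivial; eexists; eassumption. }
  assert (HQb : forall N, exists L, 0 <= L /\ forall u w, Rabs (Q u w) <= N -> Rabs u <= L /\ Rabs w <= L).
  { intros N.
    (* From [4 B Q = (2 B u + (D - A) w)^2 - disc w^2] and [- 4 C Q = (2 C w - (D - A) u)^2 - disc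
       u^2], a bound on [Q] bounds [u^2] and [w^2]. *)
    set (K := 4 * (Rabs B + Rabs C) * Rabs N / - disc).
    exists (1 + Rabs K). split; [assert (X := Rabs_pos K); lra|].
    assert (Hsq : forall u, u ^ 2 <= K -> Rabs u <= 1 + Rabs K).
    { intros u Hu. assert (X := Rle_abs K). apply Rabs_le. split; nra. }
    intros u w Hn.
    assert (HNN : N <= Rabs N) by apply Rle_abs.
    assert (Hbound : forall k z, Rabs k <= Rabs B + Rabs C -> - disc * z ^ 2 <= 4 * k * Q u w -> z ^ 2 <= K).
    { intros k z Hk Hz. unfold K. apply (Rmult_le_reg_l (- disc)); [lra|].
      replace (- disc * (4 * (Rabs B + Rabs C) * Rabs N / - disc)) with (4 * ((Rabs B + Rabs C) * Rabs N)) by (field; lra).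
      eapply Rle_trans; [apply Hz|]. rewrite Rmult_assoc. apply Rmult_le_compat_l; [lra|].
      eapply Rle_trans; [apply Rle_abs|]. rewrite Rabs_mult.
      apply Rmult_le_compat; try apply Rabs_pos; lra. }
    assert (AB := Rabs_pos B). assert (AC := Rabs_pos C).
    split; apply Hsq.
    - apply (Hbound (- C)); [rewrite Rabs_Ropp; lra|].
      assert (X := pow2_ge_0 (2 * C * w - (D - A) * u)). unfold Q, disc. nra.
    - apply (Hbound B); [lra|].
      assert (X := pow2_ge_0 (2 * B * u + (D - A) * w)). unfold Q, disc. nra. }
  destruct (HQb F) as [L1 [HL1 HL1b]]. destruct (HQb H) as [L2 [HL2 HL2b]].
  set (L := L1 + L2).
  assert (HL : forall t, Rabs (c t) <= L /\ Rabs (s t) <= L /\ Rabs (c1 t) <= L /\ Rabs (s1 t) <= L).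
  { intros t. destruct (HL1b _ _ (HF t)), (HL2b _ _ (HH t)). unfold L. lra. }
  intros t0 eps Heps.
  assert (HL0 : 0 <= L) by (unfold L; lra).
  (* Going from [t0] back to the data at 0, and from there to [t], each costs a factor [2 L]. *)
  exists (eps / (4 * L * L + 1)).
  assert (Hden : 0 < 4 * L * L + 1) by nra.
  split; [now apply Rdiv_lt_0_compat|].
  intros xi Hxi X0 X1 t _.
  apply hill_solution_linear in Hxi.
  set (xi1 := Derive xi) in *. set (del := eps / (4 * L * L + 1)) in *.
  assert (Hdel : del * (4 * L * L) < eps).
  { assert (E : del * (4 * L * L + 1) = eps) by (unfold del; field; lra).
    assert (0 < del) by now apply Rdiv_lt_0_compat. lra. }
  destruct (Hrep xi xi1 Hxi t0) as [E0 E1].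
  assert (Hal : xi 0 = xi t0 * s1 t0 - xi1 t0 * s t0).
  { rewrite E0, E1. transitivity (xi 0 * (c t0 * s1 t0 - c1 t0 * s t0)); [rewrite HW|]; ring. }
  assert (Hbe : xi1 0 = xi1 t0 * c t0 - xi t0 * c1 t0).
  { rewrite E0, E1. transitivity (xi1 0 * (c t0 * s1 t0 - c1 t0 * s t0)); [rewrite HW|]; ring. }
  assert (Hpair : forall k l u w N, 0 <= N -> Rabs k <= N -> Rabs l <= N -> Rabs u <= L -> Rabs w <= L ->
     Rabs (k * u + l * w) <= 2 * (N * L)).
  { intros k l u w N HN Hk Hl Hu Hw. eapply Rle_trans; [apply Rabs_triang|]. rewrite !Rabs_mult.
    assert (Rabs k * Rabs u <= N * L) by (apply Rmult_le_compat; trivial; apply Rabs_pos).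
    assert (Rabs l * Rabs w <= N * L) by (apply Rmult_le_compat; trivial; apply Rabs_pos). lra. }
  assert (Hdel0 : 0 <= del) by (eapply Rle_trans; [apply Rabs_pos|]; left; apply X0).
  destruct (HL t0) as [B1 [B2 [B3 B4]]]. destruct (HL t) as [B5 [B6 [B7 B8]]].
  assert (Ha0 : Rabs (xi 0) <= 2 * (del * L)).
  { rewrite Hal. replace (xi t0 * s1 t0 - xi1 t0 * s t0) with (xi t0 * s1 t0 + xi1 t0 * - s t0) by ring.
    apply Hpair; trivial; try lra. now rewrite Rabs_Ropp. }
  assert (Hb0 : Rabs (xi1 0) <= 2 * (del * L)).
  { rewrite Hbe. replace (xi1 t0 * c t0 - xi t0 * c1 t0) with (xi1 t0 * c t0 + xi t0 * - c1 t0) by ring.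
    apply Hpair; trivial; try lra. now rewrite Rabs_Ropp. }
  assert (HN : 0 <= 2 * (del * L)) by (apply Rmult_le_pos; [lra|now apply Rmult_le_pos]).
  destruct (Hrep xi xi1 Hxi t) as [-> ->].
  split; (eapply Rle_lt_trans; [apply (Hpair _ _ _ _ (2 * (del * L))); trivial|lra]).
Qed.

Lemma nonpos_unstable (a : R -> R) (M : R) :
  (forall t, continuous a t) -> (forall t, Rabs (a t) <= M) -> (forall t, a t <= 0) ->
  ~ zero_stable a.
Proof.
  intros Hc HM Ha Hst.
  destruct (Hst 0 1 Rlt_0_1) as [d [Hd Hdelta]].
  destruct (linear_solution_exists a M (d / 2) (d / 2) Hc HM) as [y [y1 [Hy [Hy0 Hy10]]]].
  (* As [y * y1] never falls below [(d / 2)^2], [y^2] gains at least [2 (d / 2)^2 T = 2] up to time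
     [T], against [|y T| < 1]. *)
  set (T := / (d / 2) ^ 2).
  assert (Hd2 : 0 < (d / 2) ^ 2) by (apply pow_lt; lra).
  assert (HT : 0 < T) by now apply Rinv_0_lt_compat.
  assert (Hb : Rabs (y T) < 1).
  { apply (Hdelta y); [now apply linear_solution_hill with y1| | |lra].
    - rewrite Hy0, Rabs_pos_eq; lra.
    - rewrite (linear_solution_Derive a y y1 0 Hy), Hy10, Rabs_pos_eq; lra. }
  assert (Hyy : forall t, 0 <= t -> (d / 2) ^ 2 <= y t * y1 t).
  { intros t Ht. replace ((d / 2) ^ 2) with (y 0 * y1 0) by (rewrite Hy0, Hy10; ring).
    apply (nonneg_derive_le (fun t => y t * y1 t) (fun t => y1 t ^ 2 - a t * y t ^ 2)); trivial.
    - intros u _. destruct (Hy u) as [Y1 Y2].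
      auto_derive; [repeat split; eexists; eassumption|].
      derive_of Y1. derive_of Y2. ring.
    - intros u _. assert (X := pow2_ge_0 (y1 u)). assert (Y := pow2_ge_0 (y u)).
      specialize (Ha u). nra. }
  assert (X : y 0 ^ 2 - 2 * (d / 2) ^ 2 * 0 <= y T ^ 2 - 2 * (d / 2) ^ 2 * T).
  { apply (nonneg_derive_le (fun t => y t ^ 2 - 2 * (d / 2) ^ 2 * t)
      (fun t => 2 * (y t * y1 t) - 2 * (d / 2) ^ 2)); [lra| |].
    - intros u _. destruct (Hy u) as [Y1 Y2].
      auto_derive; [repeat split; eexists; eassumption|]. derive_of Y1. field.
    - intros u Hu. specialize (Hyy u (proj1 Hu)). lra. }
  assert (E : (d / 2) ^ 2 * T = 1) by (unfold T; field; lra).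
  apply Rabs_def2 in Hb. assert (y T ^ 2 < 1) by nra. assert (Y := pow2_ge_0 (y 0)). nra.
Qed.

(** * Application of the criteria to the Duffing flow *)

(* The reduction-of-order solution [x \int 1/x^2], rewritten by means of [(x1 / x)' = - mu (x^2 / 2 + 2 E / x^2)]. *)
Lemma duffing_flow_second_solution (mu b E Z0 : R) (x x1 Z : R -> R) :
  duffing_flow mu b E x x1 -> (forall t, is_derive Z t (x t ^ 2)) ->
  linear_solution (fun t => mu * (x t ^ 2 - b))
    (fun t => x1 t + mu / 2 * (x t * (Z t - Z0)))
    (fun t => - (mu * (x t ^ 2 - b) * x t) + mu / 2 * (x1 t * (Z t - Z0) + x t ^ 3)).
Proof.
  intros H HZ t. destruct (H t) as [H1 [H2 _]]. assert (H3 := HZ t). split.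
  - auto_derive; [repeat split; trivial; eexists; eassumption|].
    derive_of H1. derive_of H2. derive_of H3. field.
  - auto_derive; [repeat split; trivial; eexists; eassumption|].
    derive_of H1. derive_of H2. derive_of H3. field.
Qed.

(** By periodicity [t] is moved to [s] in [[z, z + tau)]. If [s = z], the comparison solution is
    [x]. Otherwise [x] vanishes in [[s, s + tau]] only at [z + tau], where [v = x1 <> 0]; elsewhere
    [v = x w] with [w] nonincreasing on either side of [z + tau], negative at [s] and positive at
    [s + tau], so [v] has no zero. *)
Lemma duffing_no_two_zeros (mu b e nu c tau z M : R) (x x1 Z : R -> R) :
  0 < nu < mu -> 0 < b -> 0 < e -> 0 < c -> 0 < tau ->
  duffing_flow mu b (e ^ 2) x x1 ->
  x z = 0 -> (forall t, z < t < z + tau -> x t <> 0) ->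
  (forall t, x (t + tau) = - x t /\ x1 (t + tau) = - x1 t) ->
  (forall t, is_derive Z t (x t ^ 2)) -> (forall t, Z t < Z (t + tau)) ->
  (forall t, Rabs (nu * (x t ^ 2 - (b + c))) <= M) ->
  forall t y y1, linear_solution (fun t => nu * (x t ^ 2 - (b + c))) y y1 ->
    y t = 0 -> y (t + tau) = 0 -> y1 t = 0.
Proof.
  intros Hnu Hb He Hc Htau H Hxz Hne Hper HZ HZlt HM t y y1 Hy Hyt Hytau.
  set (q := fun t => mu * (x t ^ 2 - b)).
  assert (Hcoef : forall t, nu * (x t ^ 2 - (b + c)) = nu / mu * (q t - mu * c))
    by (intros; unfold q; field; lra).
  assert (HzE : forall s, x s = 0 -> x1 s <> 0).
  { intros s Hs E. destruct (H s) as [_ [_ H3]]. rewrite Hs, E in H3.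
    assert (0 < mu * e ^ 2) by (apply Rmult_lt_0_compat; [lra|now apply pow_lt]). nra. }
  destruct (period_translate tau z t Htau) as [k Hk]. set (s := t + IZR k * tau) in *.
  set (h := IZR (- k) * tau).
  assert (Hsh : s + h = t) by (unfold s, h; rewrite opp_IZR; ring).
  assert (Hys : linear_solution (fun t => nu / mu * (q t - mu * c)) (fun u => y (u + h)) (fun u => y1 (u + h))).
  { assert (X : linear_solution (fun t => nu * (x t ^ 2 - (b + c))) (fun u => y (u + h)) (fun u => y1 (u + h))).
    { apply linear_solution_shift; trivial. intros u.
      apply (periodic_Z (fun t => nu * (x t ^ 2 - (b + c)))). intros r.
      rewrite (proj1 (Hper r)). ring. }
    intros u. destruct (X u) as [X1 X2]. rewrite Hcoef in X2. now split. }
  assert (Hg : 0 < nu / mu < 1).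
  { split; [apply Rdiv_lt_0_compat; lra|]. apply (Rmult_lt_reg_r mu); [lra|].
    replace (nu / mu * mu) with nu by (field; lra). lra. }
  assert (Hmc : 0 < mu * c) by (apply Rmult_lt_0_compat; lra).
  assert (Hlt : s < s + tau) by lra.
  assert (HM' : forall t, Rabs (nu / mu * (q t - mu * c)) <= M)
    by (intros u; rewrite <- Hcoef; apply HM).
  assert (Hy0 : y (s + h) = 0) by (now rewrite Hsh).
  assert (Hy2 : y (s + tau + h) = 0).
  { replace (s + tau + h) with (t + tau) by lra. trivial. }
  rewrite <- Hsh.
  destruct (Req_dec s z) as [Hsz|Hsz].
  - apply (no_two_zeros q _ _ x x1 _ _ s (s + tau) M Hg Hmc Hlt HM' Hys); trivial.
    + now apply duffing_flow_linear with (1 := H).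
    + rewrite Hsz. trivial.
    + right. apply HzE. now rewrite Hsz.
    + right. apply HzE. rewrite Hsz, (proj1 (Hper z)), Hxz. ring.
  - assert (Hxs : x s <> 0) by (apply Hne; lra).
    (* Since [x1 / x] takes the same value at [s] and [s + tau], this constant makes the two end
       values of [w] opposite, namely [mu / 4] times [Z s - Z (s + tau)] and its negative. *)
    set (Z0 := 2 * (x1 s / x s) / mu + (Z s + Z (s + tau)) / 2).
    set (v := fun t => x1 t + mu / 2 * (x t * (Z t - Z0))).
    set (w := fun t => x1 t / x t + mu / 2 * (Z t - Z0)).
    assert (Hzt : x (z + tau) = 0) by (rewrite (proj1 (Hper z)), Hxz; ring).
    assert (Hx2 : forall u, z + tau < u <= s + tau -> x u <> 0).
    { intros u Hu. replace u with (u - tau + tau) by ring. rewrite (proj1 (Hper _)).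
      apply Ropp_neq_0_compat, Hne. lra. }
    assert (Hdec : forall p r, p <= r -> (forall u, p <= u <= r -> x u <> 0) -> w r <= w p).
    { intros p r Hpr Hx. apply Ropp_le_cancel.
      apply (nonneg_derive_le (fun u => - w u) (fun u => mu * (2 * e ^ 2 / x u ^ 2))); trivial.
      - intros u Hu. specialize (Hx u Hu). destruct (H u) as [H1 [H2 H3]]. assert (H4 := HZ u).
        unfold w. auto_derive; [repeat split; trivial; eexists; eassumption|].
        derive_of H1. derive_of H2. derive_of H4.
        apply (Rmult_eq_reg_r (x u ^ 2)); [|now apply pow_nonzero].
        transitivity (mu * (x u ^ 2 - b) * x u ^ 2 + x1 u ^ 2 - mu / 2 * x u ^ 4); [field; trivial|].
        rewrite H3. field. trivial.
      - intros u Hu. specialize (Hx u Hu). apply Rmult_le_pos; [lra|].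
        assert (0 < x u ^ 2) by nra. apply Rdiv_le_0_compat; trivial. nra. }
    assert (HZs := HZlt s).
    assert (Hws : w s < 0).
    { unfold w, Z0. replace (_ + _) with (mu * ((Z s - Z (s + tau)) / 4)) by (field; split; trivial; lra). nra. }
    assert (Hwt : 0 < w (s + tau)).
    { unfold w, Z0. destruct (Hper s) as [-> ->].
      replace (_ + _) with (mu * ((Z (s + tau) - Z s) / 4)) by (field; split; trivial; lra). nra. }
    assert (Hvw : forall u, x u <> 0 -> v u = x u * w u) by (intros u Hu; unfold v, w; field; trivial).
    assert (Hv : forall u, s <= u <= s + tau -> v u <> 0).
    { intros u Hu. destruct (Rtotal_order u (z + tau)) as [C|[->|C]].
      - assert (Hx : x u <> 0) by (apply Hne; lra).
        rewrite Hvw by trivial. apply Rmult_integral_contrapositive_currified; trivial.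
        assert (w u <= w s) by (apply Hdec; [lra|intros r Hr; apply Hne; lra]). lra.
      - unfold v. rewrite Hzt, Rmult_0_l, Rmult_0_r, Rplus_0_r. now apply HzE.
      - assert (Hx : x u <> 0) by (apply Hx2; lra).
        rewrite Hvw by trivial. apply Rmult_integral_contrapositive_currified; trivial.
        assert (w (s + tau) <= w u) by (apply Hdec; [lra|intros r Hr; apply Hx2; lra]). lra. }
    apply (no_two_zeros q _ _ v (fun t => - (mu * (x t ^ 2 - b) * x t) + mu / 2 * (x1 t * (Z t - Z0) + x t ^ 3))
      _ _ s (s + tau) M Hg Hmc Hlt HM' Hys); trivial.
    + now apply duffing_flow_second_solution with (1 := H).
    + intros u Hu. apply Hv. lra.
    + left. apply Hv. lra.
    + left. apply Hv. lra.
Qed.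

Lemma duffing_hill_coef_bounded (mu b E nu K : R) (x x1 : R -> R) :
  0 < mu -> 0 < nu -> 0 < K -> duffing_flow mu b E x x1 ->
  exists M, forall t, Rabs (nu * (x t ^ 2 - K)) <= M.
Proof.
  intros Hmu Hnu HK H. destruct (duffing_flow_bounded _ _ _ _ _ Hmu H) as [B HB].
  exists (nu * (B + K)). intros t. specialize (HB t). assert (S := pow2_ge_0 (x t)).
  apply Rabs_le. split; nra.
Qed.

(** [b + 1 <= e] provides the zeros of [x], and [3 (b + c) < e] lets the mean of [x^2], at least
    [e / 3], exceed [b + c], so that the coefficient has positive mean. *)
Lemma duffing_high_energy_stable (mu b e nu c : R) (x x1 : R -> R) :
  1 <= mu -> 0 < nu < mu -> 0 < b -> 0 < c -> b + 1 <= e -> 3 * (b + c) < e ->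
  duffing_flow mu b (e ^ 2) x x1 ->
  zero_stable (fun t => nu * (x t ^ 2 - (b + c))).
Proof.
  intros Hmu Hnu Hb Hc He He3 H.
  destruct (duffing_flow_antiperiod _ _ _ _ _ Hmu Hb He H) as [z [tau [Htau [Hz [Hne Hper]]]]].
  assert (Hxc : forall t, continuous x t) by (intros t; now apply duffing_flow_continuous with (1 := H)).
  assert (Hx2 : forall t, continuous (fun t => x t ^ 2) t).
  { intros t. apply (ex_derive_continuous (V := R_NormedModule)).
    destruct (H t) as [H1 _]. auto_derive. eexists; eassumption. }
  set (Z := fun t => RInt (fun s => x s ^ 2) 0 t).
  assert (HZ : forall t, is_derive Z t (x t ^ 2)) by (intros t; now apply (is_derive_primitive (fun s => x s ^ 2))).
  assert (Hmean : forall t, e / 3 * tau <= Z (t + tau) - Z t).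
  { intros t. apply (duffing_flow_mean_square mu b e tau t x x1 Z); trivial; lra. }
  destruct (duffing_hill_coef_bounded mu b (e ^ 2) nu (b + c) x x1) as [M HM]; trivial; try lra.
  apply (hill_stable _ (fun t => nu * (Z t - (b + c) * t)) tau M); trivial.
  - intros t. apply (ex_derive_continuous (V := R_NormedModule)).
    destruct (H t) as [H1 _]. auto_derive. eexists; eassumption.
  - intros t. rewrite (proj1 (Hper t)). ring.
  - intros t. assert (HZt := HZ t). auto_derive; [eexists; eassumption|].
    derive_of HZt. ring.
  - specialize (Hmean 0). rewrite Rplus_0_l in Hmean.
    apply Rmult_lt_compat_l; [lra|]. nra.
  - apply (duffing_no_two_zeros mu b e nu c tau z M x x1 Z); trivial; try lra.
    intros t. specialize (Hmean t). assert (0 < e / 3 * tau) by (apply Rmult_lt_0_compat; lra). lra.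
Qed.

Lemma zero_stable_ext (a a' : R -> R) :
  (forall t, a t = a' t) -> zero_stable a -> zero_stable a'.
Proof.
  intros Ha Hst t0 eps Heps. destruct (Hst t0 eps Heps) as [d [Hd Hxi]].
  exists d. split; trivial. intros xi [Hd2 He]. apply Hxi. split; trivial.
  intros t. rewrite Ha. apply He.
Qed.

Lemma hill_coef_flow (m n : nat) (P : R) (Theta : R -> R) (t : R) :
  hill_coef m n P Theta t = INR n ^ 2 * ((INR m * Theta t) ^ 2 - (P - INR m ^ 2 + (INR m ^ 2 - INR n ^ 2))).
Proof. unfold hill_coef. ring. Qed.

Lemma duffing_low_energy_unstable (m n : nat) (P : R) (Theta : R -> R) :
  (1 <= m)%nat -> (1 <= n)%nat -> INR n ^ 2 < INR m ^ 2 -> INR m ^ 2 < P ->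
  duffing_solution m P Theta ->
  energy m P Theta <=
    - ((P - INR m ^ 2) ^ 2 / 4) + (INR m ^ 2 - INR n ^ 2) ^ 2 / 4 ->
  linearly_unstable m n P Theta.
Proof.
  intros hm hn hnm hmP Hsol HE Hst.
  assert (H := duffing_solution_flow m P Theta hm Hsol).
  assert (Hm : 0 < INR m ^ 2) by (apply pow_lt, lt_0_INR; lia).
  assert (Hn : 0 < INR n ^ 2) by (apply pow_lt, lt_0_INR; lia).
  apply (zero_stable_ext _ _ (hill_coef_flow m n P Theta)) in Hst. revert Hst.
  destruct (duffing_hill_coef_bounded _ _ _ (INR n ^ 2) (P - INR m ^ 2 + (INR m ^ 2 - INR n ^ 2)) _ _ Hm Hn ltac:(lra) H) as [M HM].
  apply nonpos_unstable with M; trivial.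
  - intros t. apply (ex_derive_continuous (V := R_NormedModule)).
    destruct (proj1 Hsol t) as [D1 _]. auto_derive. trivial.
  - intros t. assert (B := duffing_flow_bound _ _ _ _ _ t Hm H).
    (* The energy threshold is exactly [4 E + b^2 <= c^2], so [B] gives [(x^2 - b)^2 <= c^2]. *)
    assert (X : (INR m * Theta t) ^ 2 - (P - INR m ^ 2) <= INR m ^ 2 - INR n ^ 2).
    { apply Rnot_lt_le. intros X. nra. }
    nra.
Qed.

Theorem theorem15 (m n : nat) (P : R)
  (hm : (1 <= m)%nat) (hn : (1 <= n)%nat)
  (hnm : INR n ^ 2 < INR m ^ 2) (hmP : INR m ^ 2 < P) :
  exists E2 : R, 0 < E2 /\
    ((forall Theta : R -> R, duffing_solution m P Theta ->
        - ((P - INR m ^ 2) ^ 2 / 4) < energy m P Theta ->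
        energy m P Theta <=
          - ((P - INR m ^ 2) ^ 2 / 4) + (INR m ^ 2 - INR n ^ 2) ^ 2 / 4 ->
        energy m P Theta <> 0 ->
        linearly_unstable m n P Theta) /\
     (2 * INR m ^ 2 - INR n ^ 2 - P >= 0 ->
      forall Theta : R -> R, duffing_solution m P Theta ->
        energy m P Theta < 0 ->
        linearly_unstable m n P Theta)) /\
    (forall Theta : R -> R, duffing_solution m P Theta ->
        E2 < energy m P Theta ->
        linearly_stable m n P Theta).
Proof.
  assert (Hn : 0 < INR n ^ 2) by (apply pow_lt, lt_0_INR; lia).
  (* [P] bounds both [b + 1 = P - m^2 + 1] and [b + c = P - n^2], so [e = sqrt E > 3 P + 1] meets
     both conditions [b + 1 <= e] and [3 (b + c) < e]. *)
  exists ((3 * P + 1) ^ 2). split; [|split; [split|]].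
  - apply pow_lt. lra.
  - intros Theta Hsol _ HE _. now apply duffing_low_energy_unstable.
  (* [Hge] says [c >= b > 0], so the threshold [(c^2 - b^2) / 4] is nonnegative. *)
  - intros Hge Theta Hsol HE. apply duffing_low_energy_unstable; trivial. nra.
  - intros Theta Hsol HE.
    assert (Hm : 1 <= INR m ^ 2) by (assert (X := le_INR _ _ hm); simpl in X; nra).
    assert (H := duffing_solution_flow m P Theta hm Hsol).
    assert (HE0 : 0 <= energy m P Theta) by (assert (X := pow2_ge_0 (3 * P + 1)); lra).
    assert (He : 3 * P + 1 < sqrt (energy m P Theta)).
    { rewrite <- (sqrt_pow2 (3 * P + 1)) by lra. apply sqrt_lt_1_alt. split; trivial. apply pow2_ge_0. }
    rewrite <- (pow2_sqrt _ HE0) in H.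
    apply (zero_stable_ext (fun t => INR n ^ 2 * ((INR m * Theta t) ^ 2 - (P - INR m ^ 2 + (INR m ^ 2 - INR n ^ 2))))).
    { intros t. now rewrite hill_coef_flow. }
    apply duffing_high_energy_stable with (7 := H); lra.
Qed.
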